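(* Let $K$ be a field. The following assertions are equivalent: (1) For any integer $n\ge1$ and any monomial ideal $I\subset S=K[x_1,\ldots,x_n]$, one has $\operatorname{sdepth}_S(I)\ge\operatorname{depth}_S(I)$. (2) For any integer $n\ge1$ and any monomial ideals $I,J\subset S=K[x_1,\ldots,x_n]$: if $\operatorname{sdepth}_S(I+J)\ge\operatorname{depth}_S(I+J)$, then $\operatorname{sdepth}_S(I)\ge\operatorname{depth}_S(I)$. (3) For any integers $n,m\ge1$ and any monomial ideal $I\subset S=K[x_1,\ldots,x_n]$, if $u_1,\ldots,u_m\in S$ are monomials forming a regular sequence on $S/I$ and $J=(u_1,\ldots,u_m)$, then $$\operatorname{sdepth}_S(I+J)\ge\operatorname{depth}_S(I+J)\ \Rightarrow\ \operatorname{sdepth}_S(I)\ge\operatorname{depth}_S(I).$$ (4) For any integers $n,m\ge1$ and any monomial ideal $I\subset S=K[x_1,\ldots,x_n]$, if $u_1,\ldots,u_m\in S$ are monomials forming a regular sequence on $S/I$ and $J=(u_1,\ldots,u_m)$, then $$\operatorname{sdepth}_S(I+J)=\operatorname{depth}_S(I+J)\ \Rightarrow\ \operatorname{sdepth}_S(I)=\operatorname{depth}_S(I).$$ (5) For any integer $n\ge1$ and any monomial ideal $I\subset S=K[x_1,\ldots,x_n]$, with $\bar S=S[y]$ for a new variable $y$ and $(I,y)\subset\bar S$ the ideal generated by $I$ and $y$, $$\operatorname{sdepth}_{\bar S}((I,y))=\operatorname{depth}_S(I)\ \Rightarrow\ \operatorname{sdepth}_S(I)=\operatorname{depth}_S(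I).$$
   Context: Let $R$ be a polynomial ring over a field $K$ in finitely many variables $X$, with its multigrading by exponent vectors, and let $M\neq 0$ be a finitely generated multigraded $R$-module (for instance a quotient of monomial ideals). A Stanley decomposition of $M$ is a finite direct sum decomposition of $K$-vector spaces $\mathcal D: M=\bigoplus_{i=1}^t m_iK[Z_i]$, where the $m_i\in M$ are homogeneous, $Z_i\subset X$, and each $m_iK[Z_i]$ is a free $K[Z_i]$-module. Put $\operatorname{sdepth}(\mathcal D)=\min_i|Z_i|$, and let $\operatorname{sdepth}_R(M)$ be the maximum of $\operatorname{sdepth}(\mathcal D)$ over all Stanley decompositions of $M$. The depth $\operatorname{depth}_R(M)$ is taken with respect to the ideal generated by all variables of $R$. Both invariants are considered only for nonzero modules; monomial ideals in the assertions are nonzero and proper. *)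

(* Defs.v *)
From mathcomp Require Import all_boot all_order all_algebra.
From mathcomp Require Import boolp classical_sets.
From mathcomp Require Import mpoly.

Set Implicit Arguments.
Unset Strict Implicit.
Unset Printing Implicit Defensive.

Import GRing.Theory.

Local Open Scope ring_scope.
Local Open Scope classical_set_scope.

(* The value is 0 if A has no largest element. *)
Definition nat_max (A : set nat) : nat := xget 0%N (A `&` ubound A).

Section Ideals.
Variable R : comNzRingType.
Implicit Types I J N P : set R.

Definition is_ideal I : Prop :=
  [/\ I 0,
      forall a b, I a -> I b -> I (a + b)
    & forall r a, I a -> I (r * a)].

Definition ideal_gen (G : set R) : set R := smallest is_ideal G.

Definition ideal_add I J : set R := [set a + b | a in I & b in J].

Definition ideal_mul I J : set R := ideal_gen [set a * b | a in I & b in J].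

(* For ideals P `<=` N of R, s = [:: f_1; ...; f_d] is a regular sequence on
   the R-module Q = N / P: f_(i+1) is a nonzerodivisor on Q / (f_1, ..., f_i)Q
   for all i < d, and Q / (f_1, ..., f_d)Q <> 0.
   The preimage of (f_1, ..., f_i)Q in N is P + (f_1, ..., f_i)N. *)
Definition regular_seq N P (s : seq R) : Prop :=
  let Q_ i := ideal_add P (ideal_mul (ideal_gen [set` take i s]) N) in
  (forall i, (i < size s)%N ->
     forall a, N a -> Q_ i (nth 0 s i * a) -> Q_ i a)
  /\ ~ (N `<=` Q_ (size s)).

End Ideals.

Section MonomialIdeals.
Variables (K : fieldType) (n : nat).
Local Notation S := {mpoly K[n]}.
Implicit Types (I : set S) (Z : {set 'I_n}).

Definition irrelevant_ideal : set S := ideal_gen (range (fun i : 'I_n => 'X_i)).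

(* The depth of I as an S-module, with respect to the ideal of all variables. *)
Definition depth I : nat :=
  nat_max [set d | exists s : seq S,
    [/\ size s = d,
        forall f, f \in s -> irrelevant_ideal f
      & regular_seq I [set 0] s]].

Definition monomial_ideal I : Prop :=
  exists G : set 'X_{1..n}, I = ideal_gen [set 'X_[a] | a in G].

Definition proper_nz_monomial_ideal I : Prop :=
  [/\ monomial_ideal I, I <> [set 0] & I <> [set: S]].

Definition multihomogeneous (f : S) : Prop :=
  exists (c : K) (a : 'X_{1..n}), f = c *: 'X_[a].

(* K[Z] as a subset of S. *)
Definition polys_in Z : set S :=
  [set p | forall a, a \in msupp p -> forall i, i \notin Z -> a i = 0%N].

Definition stanley_space (m : S) Z : set S := [set m * p | p in polys_in Z].

Definition stanley_decomposition I (t : nat)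
    (m : 'I_t -> S) (Z : 'I_t -> {set 'I_n}) : Prop :=
  let family := [set g : 'I_t -> S | forall i, stanley_space (m i) (Z i) (g i)] in
  [/\ forall i, I (m i) /\ multihomogeneous (m i),
      (* each m_i K[Z_i] is free over K[Z_i] *)
      forall i p, polys_in (Z i) p -> m i * p = 0 -> p = 0,
      I = [set \sum_i g i | g in family]
      (* the sum of the m_i K[Z_i] is direct *)
    & forall g, family g -> \sum_i g i = 0 -> forall i, g i = 0].

(* As #|Z i| <= n, the default value n is irrelevant when 0 < t, which always
   holds for a decomposition of a nonzero ideal. *)
Definition sdepth_decomposition (t : nat) (Z : 'I_t -> {set 'I_n}) : nat :=
  \big[minn/n]_(i < t) #|Z i|.

Definition sdepth I : nat :=
  nat_max [set d | exists (t : nat) (m : 'I_t -> S) (Z : 'I_t -> {set 'I_n}),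
    stanley_decomposition I m Z /\ d = sdepth_decomposition Z].

End MonomialIdeals.

(* The ideal (I, y) of S[y], where S[y] = {mpoly K[n.+1]} and y is the last
   variable. *)
Definition ideal_adjoin_var (K : fieldType) (n : nat) (I : set {mpoly K[n]}) :
    set {mpoly K[n.+1]} :=
  ideal_gen ([set mwiden f | f in I] `|` [set 'X_ord_max]).

(* Main.v *)
Require Import Defs.
From mathcomp Require Import all_boot all_order all_algebra.
From mathcomp Require Import boolp classical_sets.
From mathcomp Require Import mpoly.
From mathcomp Require Import ring zify.

Set Implicit Arguments.
Unset Strict Implicit.
Unset Printing Implicit Defensive.

Import Order.TTheory GRing.Theory.

Local Open Scope ring_scope.
Local Open Scope classical_set_scope.

(** The proposition rests on the comparison of [depth] and [sdepth] of a monomial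
    ideal [I] with those of the ideals obtained from it by adding monomials that
    are regular modulo [I], or by adjoining a new variable [y].

    Depth. By [leq_depthP] the depth of [I] is the first degree in which the
    Koszul cohomology of the variables with values in [I] does not vanish.
    A regular sequence in the ideal of the variables bounds this degree from
    below ([kacyclic_of_regular]).  Conversely a module without socle over a
    noetherian ring admits a regular element in that ideal ([exists_nzd]), and
    dividing by it shifts the vanishing range by one ([regular_of_kacyclic]).
    Long exact sequences then give [depth (I + J) + m <= depth I] for a
    sequence of [m] monomials, up to truncation at the dimension
    ([depth_add_regular]), and [depth I <= depth (I, y)] ([depth_adjoin_var]).
    The depth of an ideal that contains all but [n] of the variables is at most
    [n + 1] ([depth_of_variables]).

    Stanley depth. A Stanley decomposition of a monomial ideal is the same as a
    partition of its set of exponents into pieces [m + N^Z] ([leq_sdepthP]), so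
    [sdepth] is combinatorial.  Explicit partitions give
    [sdepth I <= sdepth (I + J) + m] ([sdepth_add_regular]) and
    [sdepth I <= sdepth (I, y) <= sdepth I + 1] ([sdepth_adjoin_ge],
    [sdepth_adjoin_le]), and show that the Stanley depth of an ideal tends to
    infinity with the number of variables that it contains
    ([has_partition_variables]).

    The equivalence. The implications from (1) to (2) and from (2) to (3) are
    specializations, and (4) follows from (3) since the two comparisons for
    [I + J] turn an equality for [I + J] into [sdepth I <= depth I].  If (1)
    fails for [I], adjoin variables [y_1, y_2, ...] to [I]: the depth never
    decreases and stays bounded, whereas the Stanley depth tends to infinity by
    steps of at most 1.  Hence some [I' = (I, y_1, ..., y_k)] satisfies
    [sdepth I' < depth I' = sdepth (I', y) = depth (I', y)]
    ([exists_critical]).  This contradicts (5) for [I'] directly, and it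
    contradicts (4) for the extension of [I'] to [S[y]] and the regular element
    [y], as this extension has Stanley depth at most [sdepth I' + 1] and depth
    at least [depth I' + 1].  So (4) implies (1), and (1) implies (5) by
    [sdepth I <= sdepth (I, y)]. *)

(** * Ideals and the Koszul complex *)

Section IdealTheory.
Variable R : comNzRingType.
Implicit Types I J N P : set R.

Lemma ideal0 I : is_ideal I -> I 0.
Proof. by case. Qed.

Lemma idealD I a b : is_ideal I -> I a -> I b -> I (a + b).
Proof. by case=> _ h _; exact: h. Qed.

Lemma idealMl I r a : is_ideal I -> I a -> I (r * a).
Proof. by case=> _ _ h; exact: h. Qed.

Lemma idealMr I r a : is_ideal I -> I a -> I (a * r).
Proof. by rewrite mulrC; exact: idealMl. Qed.

Lemma idealN I a : is_ideal I -> I a -> I (- a).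
Proof. by move=> iI Ia; rewrite -mulN1r; exact: idealMl. Qed.

Lemma idealB I a b : is_ideal I -> I a -> I b -> I (a - b).
Proof. by move=> iI Ia Ib; apply: idealD => //; exact: idealN. Qed.

Lemma ideal_sum I (T : Type) (r : seq T) (Q : pred T) (F : T -> R) :
  is_ideal I -> (forall i, Q i -> I (F i)) -> I (\sum_(i <- r | Q i) F i).
Proof.
move=> iI h; apply: (big_ind I) => //; first exact: ideal0.
by move=> a b; exact: idealD.
Qed.

Lemma idealDr I a b : is_ideal I -> I b -> I (a + b) -> I a.
Proof. by move=> iI Ib Iab; rewrite -(addrK b a); exact: idealB. Qed.

Lemma is_ideal_set0 : is_ideal [set (0 : R)].
Proof. by split=> //= [a b -> ->|r a ->]; rewrite ?addr0 ?mulr0. Qed.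

Lemma is_ideal_setT : is_ideal [set: R].
Proof. by []. Qed.

Lemma ideal_gen_ideal (G : set R) : is_ideal (ideal_gen G).
Proof.
split=> [J [[J0 _ _] _] //|a b ha hb J hJ|r a ha J hJ].
  by apply: idealD (ha J hJ) (hb J hJ); case: hJ.
by apply: idealMl (ha J hJ); case: hJ.
Qed.

Lemma ideal_gen_sub (G J : set R) : is_ideal J -> G `<=` J -> ideal_gen G `<=` J.
Proof. by move=> iJ GJ a; apply. Qed.

Lemma sub_ideal_gen (G : set R) : G `<=` ideal_gen G.
Proof. by move=> a Ga J [_]; apply. Qed.

Lemma ideal_add_ideal I J : is_ideal I -> is_ideal J -> is_ideal (ideal_add I J).
Proof.
move=> iI iJ; split.
- by exists 0; [exact: ideal0|exists 0; [exact: ideal0|rewrite addr0]].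
- move=> _ _ [a Ia [b Jb <-]] [c Ic [d Jd <-]].
  exists (a + c); first exact: idealD.
  by exists (b + d); [exact: idealD|rewrite addrACA].
- move=> r _ [a Ia [b Jb <-]]; exists (r * a); first exact: idealMl.
  by exists (r * b); [exact: idealMl|rewrite mulrDr].
Qed.

Lemma ideal_addl I J : is_ideal J -> I `<=` ideal_add I J.
Proof. by move=> iJ a Ia; exists a => //; exists 0; [exact: ideal0|rewrite addr0]. Qed.

Lemma ideal_addr I J : is_ideal I -> J `<=` ideal_add I J.
Proof. by move=> iI a Ia; exists 0; [exact: ideal0|exists a => //; rewrite add0r]. Qed.

Lemma ideal_add_sub I J N : is_ideal N -> I `<=` N -> J `<=` N -> ideal_add I J `<=` N.
Proof. by move=> iN IN JN _ [a /IN Na [b /JN Nb <-]]; exact: idealD. Qed.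

Definition scale_set (f : R) N : set R := [set f * a | a in N].

Lemma scale_set_ideal f N : is_ideal N -> is_ideal (scale_set f N).
Proof.
move=> iN; split.
- by exists 0; [exact: ideal0|rewrite mulr0].
- by move=> _ _ [a Na <-] [b Nb <-]; exists (a + b); [exact: idealD|rewrite mulrDr].
- by move=> r _ [a Na <-]; exists (r * a); [exact: idealMl|rewrite mulrCA].
Qed.

Lemma add_scale_ideal P f N :
  is_ideal P -> is_ideal N -> is_ideal (ideal_add P (scale_set f N)).
Proof. by move=> iP iN; apply: ideal_add_ideal => //; exact: scale_set_ideal. Qed.

End IdealTheory.

Section Koszul.
Variables (R : comNzRingType) (n : nat) (x : 'I_n -> R).
Implicit Types (A B : {set 'I_n}) (c b : {set 'I_n} -> R) (N P : set R).

Definition ksign (j : 'I_n) A : R := \prod_(k in A) (if (k < j)%N then -1 else 1).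

Lemma ksignU j k A : k \notin A ->
  ksign j (k |: A)%SET = (if (k < j)%N then -1 else 1) * ksign j A.
Proof. by move=> kA; rewrite /ksign big_setU1. Qed.

Lemma ksignUid j A : j \notin A -> ksign j (j |: A)%SET = ksign j A.
Proof. by move=> jA; rewrite ksignU // ltnn mul1r. Qed.

Lemma ksign_sq j A : ksign j A * ksign j A = 1.
Proof.
rewrite /ksign -big_split /= big1 // => k _.
by case: ifP => _; rewrite ?mulrNN mulr1.
Qed.

Lemma ksign_anti (j k : 'I_n) : j != k ->
  (if (k < j)%N then -1 else 1) = - (if (j < k)%N then -1 else 1) :> R.
Proof. by rewrite -val_eqE /=; case: ltngtP => // _ _; rewrite opprK. Qed.

(** The Koszul differential of [x]: a cochain [c] stands for the element
    [\sum_A c A e_A] of the exterior algebra, and the differential is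
    multiplication by [\sum_j x_j e_j]. *)
Definition kdiff c A : R := \sum_(j in A) ksign j A * x j * c (A :\ j)%SET.

Lemma kdiffD c b A : kdiff (fun B => c B + b B) A = kdiff c A + kdiff b A.
Proof. by rewrite /kdiff -big_split /=; apply: eq_bigr => j _; rewrite mulrDr. Qed.

Lemma kdiffB c b A : kdiff (fun B => c B - b B) A = kdiff c A - kdiff b A.
Proof.
by rewrite /kdiff -sumrB; apply: eq_bigr => j _; rewrite mulrBr.
Qed.

Lemma kdiffZ r c A : kdiff (fun B => r * c B) A = r * kdiff c A.
Proof. by rewrite /kdiff mulr_sumr; apply: eq_bigr => j _; rewrite mulrCA. Qed.

Lemma kdiff_sum (T : finType) (F : T -> {set 'I_n} -> R) A :
  kdiff (fun B => \sum_t F t B) A = \sum_t kdiff (F t) A.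
Proof.
rewrite /kdiff exchange_big /=; apply: eq_bigr => j _.
by rewrite mulr_sumr.
Qed.

(* In degree i the differential only reads the values in degree i - 1. *)
Lemma eq_kdiff i c b A : #|A| = i ->
  (forall B, #|B|.+1 = i -> c B = b B) -> kdiff c A = kdiff b A.
Proof.
move=> Ai h; apply: eq_bigr => j jA; rewrite h //.
by rewrite -Ai (cardsD1 j A) jA.
Qed.

Lemma kdiff_in N i c A : is_ideal N -> #|A| = i ->
  (forall B, #|B|.+1 = i -> N (c B)) -> N (kdiff c A).
Proof.
move=> iN Ai h; apply: ideal_sum => // j jA; apply: idealMl => //.
by apply: h; rewrite -Ai (cardsD1 j A) jA.
Qed.

(** An antisymmetric double sum with zero diagonal cancels in pairs, whatever the
    characteristic. *)
Lemma sum_antisym (F : 'I_n -> 'I_n -> R) :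
  (forall j, F j j = 0) -> (forall j k, j != k -> F j k = - F k j) ->
  \sum_j \sum_k F j k = 0.
Proof.
move=> F0 FN.
have split3 j : \sum_k F j k = \sum_(k : 'I_n | (k < j)%N) F j k + \sum_(k : 'I_n | (j < k)%N) F j k.
  rewrite (bigID (fun k : 'I_n => (k < j)%N)) /=; congr (_ + _).
  rewrite (bigD1 j) /= ?ltnn // F0 add0r; apply: eq_bigl => k.
  by rewrite -leqNgt -val_eqE /= ltn_neqAle andbC eq_sym.
rewrite (eq_bigr _ (fun j _ => split3 j)) big_split /=.
rewrite [X in _ + X](exchange_big_dep predT) //= -big_split /=.
apply: big1 => j _; rewrite -big_split /=; apply: big1 => k kj.
by rewrite FN ?addNr // -val_eqE /= gtn_eqF.
Qed.

Lemma kdiff_kdiff c A : kdiff (kdiff c) A = 0.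
Proof.
pose F j k := if [&& j \in A, k \in A & k != j] then
  ksign j A * x j * (ksign k (A :\ j)%SET * x k * c (A :\ j :\ k)%SET) else 0.
transitivity (\sum_j \sum_k F j k).
  rewrite /kdiff big_mkcond /=; apply: eq_bigr => j _; rewrite /F.
  case: (boolP (j \in A)) => jA /=; last by rewrite big1.
  rewrite mulr_sumr big_mkcond /=; apply: eq_bigr => k _.
  by rewrite !inE andbC.
apply: sum_antisym => [j|j k jk]; first by rewrite /F eqxx !andbF.
rewrite /F (eq_sym j k) andbCA; case: ifP => [/and3P[kA jA kj]|]; last by rewrite oppr0.
have BE : (A :\ k :\ j = A :\ j :\ k)%SET by rewrite !finset.setDDl finset.setUC.
rewrite BE; set B := (A :\ j :\ k)%SET.
have jB : j \notin B by rewrite !inE eqxx andbF.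
have kB : k \notin B by rewrite !inE eqxx.
have Ajk : (A :\ j = k |: B)%SET by rewrite finset.setD1K // !inE kj.
have Akj : (A :\ k = j |: B)%SET.
  by rewrite /B -BE finset.setD1K // !inE eq_sym kj.
have AB : (A = j |: (k |: B))%SET by rewrite -Ajk finset.setD1K.
rewrite Ajk Akj !ksignUid //.
have -> : ksign j A = (if (k < j)%N then -1 else 1) * ksign j B.
  by rewrite AB ksignUid ?ksignU // in_setU1 negb_or eq_sym kj.
have -> : ksign k A = (if (j < k)%N then -1 else 1) * ksign k B.
  by rewrite AB finset.setUCA ksignUid ?ksignU // in_setU1 negb_or kj.
by rewrite (ksign_anti jk); ring.
Qed.

(** Contraction with the j-th basis vector: a homotopy between multiplication
    by [x j] and 0, which is why the ideal [(x)] annihilates the cohomology. *)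
Definition kcontr (j : 'I_n) c A : R :=
  if j \in A then 0 else ksign j A * c (j |: A)%SET.

Lemma kcontr_homotopy j c A :
  kdiff (kcontr j c) A + kcontr j (kdiff c) A = x j * c A.
Proof.
rewrite [kcontr j (kdiff c) A]/kcontr; case: ifPn => jA.
  rewrite addr0 /kdiff (bigD1 j) //= [X in _ + X]big1 ?addr0.
    rewrite /kcontr !inE eqxx /= finset.setD1K //.
    have <- : ksign j A = ksign j (A :\ j)%SET.
      by rewrite -[in LHS](finset.setD1K jA) ksignUid // !inE eqxx.
    have -> (s : R) : s * x j * (s * c A) = s * s * (x j * c A) by ring.
    by rewrite ksign_sq mul1r.
  move=> k /andP[kA kj]; rewrite /kcontr !inE (eq_sym j k) kj jA /=.
  by rewrite mulr0.
rewrite [in X in _ + X]/kdiff big_setU1 //= ksignUid // finset.setU1K // mulrDr.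
rewrite !mulrA ksign_sq mul1r addrCA -[RHS]addr0; congr (_ + _).
rewrite mulr_sumr /kdiff -big_split big1 // => k kA /=.
have kj : k != j by apply: contraNneq jA => <-.
rewrite /kcontr !inE (negbTE jA) andbF.
have -> : ((j |: A) :\ k = j |: (A :\ k))%SET.
  apply/setP => i; rewrite !inE; case: (eqVneq i j) => [->|_] //=.
  by rewrite eq_sym kj.
have jB : j \notin (A :\ k)%SET by rewrite !inE (negbTE jA) andbF.
have kB : k \notin (A :\ k)%SET by rewrite !inE eqxx.
have sk : ksign k A = ksign k (A :\ k)%SET.
  by rewrite -[in LHS](finset.setD1K kA) ksignUid.
have sj : ksign j A = (if (k < j)%N then -1 else 1) * ksign j (A :\ k)%SET.
  by rewrite -[in LHS](finset.setD1K kA) ksignU.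
rewrite (ksignU k jA) sj sk (ksign_anti (j := j) (k := k)) 1?eq_sym //.
case: ifP => _; ring.
Qed.

(** Vanishing of the i-th Koszul cohomology of the module [N / P]. Cochains are
    functions on all subsets, and only their values in the relevant degree are
    constrained; this avoids a separate type of homogeneous cochains. *)
Definition kacyclic N P (i : nat) : Prop :=
  forall c, (forall A, N (c A)) -> (forall A, #|A| = i.+1 -> P (kdiff c A)) ->
  exists2 b, (forall A, N (b A)) & forall A, #|A| = i -> P (c A - kdiff b A).

Definition generated_by_x : set R := [set f | exists g : 'I_n -> R, f = \sum_j g j * x j].

End Koszul.

Section KoszulRegular.
Variables (R : comNzRingType) (n : nat) (x : 'I_n -> R).
Implicit Types (A B : {set 'I_n}) (N P I : set R) (f u y : R).

Definition nzd_on N P f : Prop := forall a, N a -> P (f * a) -> P a.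

(** A primitive only matters in degree [i - 1] and may be reset to 0 elsewhere. *)
Lemma kacyclic_extend_primitive N P i (c : {set 'I_n} -> R) : is_ideal N ->
  (exists2 b, (forall A, #|A|.+1 = i -> N (b A))
            & forall A, #|A| = i -> P (c A - kdiff x b A)) ->
  exists2 b, (forall A, N (b A)) & forall A, #|A| = i -> P (c A - kdiff x b A).
Proof.
move=> iN [b Nb Pb]; exists (fun A => if #|A|.+1 == i then b A else 0).
  by move=> A; case: eqP => [/Nb//|_]; exact: ideal0.
move=> A Ai; rewrite (eq_kdiff x (b := b) Ai); first exact: Pb.
by move=> B ->; rewrite eqxx.
Qed.

Lemma kcontr_sum (g : 'I_n -> R) (c : {set 'I_n} -> R) A :
  (\sum_j g j * x j) * c A
    - kdiff x (fun B => \sum_j g j * kcontr j c B) A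
  = \sum_j g j * kcontr j (kdiff x c) A.
Proof.
rewrite kdiff_sum mulr_suml -sumrB; apply: eq_bigr => j _.
by rewrite kdiffZ -mulrA -(kcontr_homotopy x j c A) mulrDr addrC addKr.
Qed.

Lemma kcontr_in I j i (c : {set 'I_n} -> R) A : is_ideal I -> #|A| = i ->
  (forall B, #|B| = i.+1 -> I (c B)) -> I (kcontr j c A).
Proof.
move=> iI Ai Ic; rewrite /kcontr; case: ifPn => jA; first exact: ideal0.
by apply: idealMl => //; apply: Ic; rewrite finset.cardsU1 jA Ai.
Qed.

Lemma contraction_sum_in I i (g : 'I_n -> R) (c : {set 'I_n} -> R) A :
  is_ideal I -> #|A| = i ->
  (forall B, #|B| = i.+1 -> I (c B)) -> I (\sum_j g j * kcontr j c A).
Proof.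
move=> iI Ai Ic; apply: ideal_sum => // j _; apply: idealMl => //.
exact: (kcontr_in _ iI Ai Ic).
Qed.

Lemma kdiff_set0 (c : {set 'I_n} -> R) : kdiff x c finset.set0 = 0.
Proof. by rewrite /kdiff big_set0. Qed.

Lemma scale_choice P N f (D : {set 'I_n} -> Prop) (c : {set 'I_n} -> R) :
  is_ideal N -> (forall A, D A -> ideal_add P (scale_set f N) (c A)) ->
  exists2 w : {set 'I_n} -> R, (forall A, N (w A)) & forall A, D A -> P (c A - f * w A).
Proof.
move=> iN h.
have /choice[w hw] A : exists w, N w /\ (D A -> P (c A - f * w)).
  have [dA|nA] := pselect (D A); last by exists 0; split => //; exact: ideal0.
  have [p Pp [_ [w Nw <-] cE]] := h _ dA.
  by exists w; split => // _; rewrite -cE addrK.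
by exists w => A; have [] := hw A.
Qed.

(** In the long exact sequence of multiplication by [f] on [N / P], the map [f]
    is 0 on cohomology because [f] lies in [(x)], and it is injective in degree
    [i] because the cohomology of the quotient vanishes in degree [i - 1]. *)
Lemma kacyclic_of_nzd N P f i : is_ideal N -> is_ideal P ->
  generated_by_x x f -> nzd_on N P f ->
  (if i is k.+1 then kacyclic x N (ideal_add P (scale_set f N)) k else True) ->
  kacyclic x N P i.
Proof.
move=> iN iP [g fE] nzf hi c Nc Pdc.
(* [w] is the contraction of [c] by [f]: its differential is [f c] modulo [P]. *)
pose w B := \sum_j g j * kcontr j c B.
have Nw A : N (w A) by apply: (contraction_sum_in _ iN erefl).
have Pfc A : #|A| = i -> P (f * c A - kdiff x w A).
  by move=> Ai; rewrite fE kcontr_sum; apply: (contraction_sum_in _ iP Ai).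
case: i => [|i] in hi Pdc Pfc *.
  exists (fun=> 0) => [A|A Ai]; first exact: ideal0.
  have A0 : A = finset.set0 by apply/eqP; rewrite -cards_eq0 Ai.
  rewrite A0 kdiff_set0 subr0; apply: nzf => //.
  by have := Pfc _ Ai; rewrite A0 kdiff_set0 subr0.
have [||v Nv wv] := hi w => //.
  move=> A Ai; exists (- (f * c A - kdiff x w A)); first by apply: idealN => //; exact: Pfc.
  exists (f * c A); first by exists (c A).
  by rewrite opprB subrK.
have [w' Nw' Pw] := scale_choice iN wv.
exists w' => // A Ai; apply: nzf.
  by apply: idealB => //; apply: (kdiff_in _ _ Ai).
have -> : f * (c A - kdiff x w' A) = (f * c A - kdiff x w A) +
   kdiff x (fun B => w B - kdiff x v B - f * w' B) A.
  by rewrite !kdiffB kdiff_kdiff kdiffZ; ring.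
apply: idealD => //; first exact: Pfc.
by apply: (kdiff_in _ _ Ai) => // B [/Pw].
Qed.

(** The long exact sequence of multiplication by [f] on [N / P]. *)
Lemma kacyclic_quotient N P f i : is_ideal N -> is_ideal P -> nzd_on N P f ->
  kacyclic x N P i -> kacyclic x N P i.+1 ->
  kacyclic x N (ideal_add P (scale_set f N)) i.
Proof.
move=> iN iP nzf acy acyS c Nc Pdc.
have [w Nw Pw] := scale_choice iN Pdc.
have Pdw A : #|A| = i.+2 -> P (kdiff x w A).
  move=> Ai; apply: nzf; first by apply: (kdiff_in _ _ Ai).
  have -> : f * kdiff x w A = - kdiff x (fun B => kdiff x c B - f * w B) A.
    by rewrite kdiffB kdiff_kdiff kdiffZ sub0r opprK.
  by apply: idealN => //; apply: (kdiff_in _ _ Ai) => // B [/Pw].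
have [v Nv Pv] := acyS w Nw Pdw.
have [||t Nt Pt] := acy (fun A => c A - f * v A).
- by move=> A; apply: idealB => //; exact: idealMl.
- move=> A Ai; rewrite kdiffB kdiffZ.
  have -> : kdiff x c A - f * kdiff x v A =
    (kdiff x c A - f * w A) + f * (w A - kdiff x v A) by ring.
  by apply: idealD => //; [exact: Pw|apply: idealMl => //; exact: Pv].
exists t => // A Ai; exists (c A - f * v A - kdiff x t A); first exact: Pt.
by exists (f * v A); [exists (v A)|ring].
Qed.

(** The long exact sequence of [0 -> u I -> I -> I / u I -> 0] in disguise:
    [I / u I] is [(I + (u)) / (u)], whose cohomology is that of [I + (u)] below
    the top degree, and [u] acts as 0 on the cohomology of [I]. *)
Lemma kacyclic_add_nzd I u d : is_ideal I -> generated_by_x x u ->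
  (forall a, I (u * a) -> I a) ->
  (forall i, (i < n)%N -> kacyclic x setT [set 0] i) ->
  (forall i, (i < d)%N -> kacyclic x (ideal_add I (scale_set u setT)) [set 0] i) ->
  forall i, (i <= d)%N -> (i < n)%N -> kacyclic x I [set 0] i.
Proof.
move=> iI [g uE] Iu acyS acyL i led ltn c Ic dc0.
apply: kacyclic_extend_primitive => //.
have [s _ cs] := acyS i ltn c (fun=> Logic.I) dc0.
case: i => [|i] in led ltn dc0 cs *; first by exists s.
pose w B := \sum_j g j * kcontr j c B.
have Iw A : I (w A) by apply: (contraction_sum_in _ iI erefl).
have uc A : #|A| = i.+1 -> u * c A = kdiff x w A.
  move=> Ai; apply/eqP; rewrite -subr_eq0 uE kcontr_sum; apply/eqP.
  by apply: (contraction_sum_in g (is_ideal_set0 R) Ai) => B; exact: dc0.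
have cE A : #|A| = i.+1 -> c A = kdiff x s A.
  by move=> /cs/eqP; rewrite subr_eq0 => /eqP.
have [|||v Lv wv] := acyL i _ (fun A => w A - u * s A) => //.
- move=> A; exists (w A) => //; exists (- (u * s A)) => //.
  by exists (- s A) => //; rewrite mulrN.
- by move=> A Ai; rewrite /= kdiffB kdiffZ -uc // -cE // subrr.
have [v2 _ Iv] := scale_choice (D := fun=> True) (is_ideal_setT R) (fun A _ => Lv A).
exists (fun A => s A + kdiff x v2 A) => [A [Ai]|A Ai].
  apply: Iu.
  have -> : u * (s A + kdiff x v2 A) = w A - (w A - u * s A - kdiff x v A)
     - kdiff x (fun B => v B - u * v2 B) A by rewrite kdiffB kdiffZ; ring.
  rewrite wv // subr0; apply: idealB => //; apply: (kdiff_in _ _ Ai) => // B _.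
  exact: Iv.
by rewrite /= kdiffD kdiff_kdiff addr0 -cE // subrr.
Qed.

(** The estimate in the other direction, from the exact sequence
    [0 -> u I -> I + u S (direct sum) -> I + (u) -> 0]. *)
Lemma kacyclic_add_nzd_ge I u d : is_ideal I ->
  (forall a, I (u * a) -> I a) ->
  (forall i, (i < n)%N -> kacyclic x setT [set 0] i) ->
  (forall i, (i < d.+1)%N -> kacyclic x I [set 0] i) ->
  forall i, (i < d)%N -> (i < n)%N ->
    kacyclic x (ideal_add I (scale_set u setT)) [set 0] i.
Proof.
move=> iI Iu acyS acyI i ltd ltn z Lz dz0.
have [b _ Iz] := scale_choice (D := fun=> True) (is_ideal_setT R) (fun A _ => Lz A).
have {}Iz A : I (z A - u * b A) by exact: Iz.
pose a A := z A - u * b A.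
have Idb A : #|A| = i.+1 -> I (kdiff x b A).
  move=> Ai; apply: Iu.
  have -> : u * kdiff x b A = kdiff x z A - kdiff x a A.
    by rewrite /a kdiffB kdiffZ; ring.
  rewrite dz0 // sub0r; apply: idealN => //.
  by apply: (kdiff_in _ iI Ai) => B _; exact: Iz.
have [|A|A Ai|c Ic bc] := acyI i.+1 _ (fun A => if #|A| == i.+1 then kdiff x b A else 0).
- by [].
- by case: eqP => [/Idb//|_]; exact: ideal0.
- rewrite /= (eq_kdiff x (b := kdiff x b) Ai) ?kdiff_kdiff //.
  by move=> B [->]; rewrite eqxx.
have {}bc A : #|A| = i.+1 -> kdiff x b A = kdiff x c A.
  by move=> Ai; have /eqP := bc A Ai; rewrite Ai eqxx subr_eq0 => /eqP.
have [|A|A Ai|a' Ia' aa'] := acyI i _ (fun A => a A + u * c A).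
- exact: leqW.
- by apply: idealD => //; [exact: Iz|exact: idealMl].
- by rewrite /= kdiffD kdiffZ -bc // /a kdiffB kdiffZ subrK; exact: dz0.
have [//|A Ai|e _ be] := acyS i ltn (fun A => b A - c A).
  by rewrite /= kdiffB bc // subrr.
exists (fun A => a' A + u * e A) => [A|A Ai].
  by exists (a' A) => //; exists (u * e A) => //; exists (e A).
have -> : z A - kdiff x (fun B => a' B + u * e B) A =
  (a A + u * c A - kdiff x a' A) + u * (b A - c A - kdiff x e A).
  by rewrite kdiffD kdiffZ /a; ring.
by rewrite /= aa' // be // mulr0 addr0.
Qed.

End KoszulRegular.

Section RegularLists.
Variable R : comNzRingType.
Implicit Types (N P I J : set R) (s : seq R).

(** [N / quot_ideal N P s] is the quotient of [N / P] by the submodule generated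
    by the multiples of the entries of [s], taken one entry at a time so that
    regular sequences can be treated by induction on [s]. *)
Fixpoint quot_ideal N P s : set R :=
  if s is f :: s' then quot_ideal N (ideal_add P (scale_set f N)) s' else P.

Fixpoint regular_list N P s : Prop :=
  if s is f :: s' then
    nzd_on N P f /\ regular_list N (ideal_add P (scale_set f N)) s'
  else True.

Lemma quot_ideal_ideal N P s : is_ideal N -> is_ideal P -> is_ideal (quot_ideal N P s).
Proof.
by move=> iN; elim: s P => [|f s IHs] P iP //=; apply/IHs/add_scale_ideal.
Qed.

Lemma quot_ideal_base N P s : is_ideal N -> P `<=` quot_ideal N P s.
Proof.
move=> iN; elim: s P => [|f s IHs] P //= a Pa; apply: IHs.
by apply: ideal_addl => //; exact: scale_set_ideal.
Qed.

Lemma quot_ideal_mem N P s f a : is_ideal N -> is_ideal P ->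
  f \in s -> N a -> quot_ideal N P s (f * a).
Proof.
move=> iN; elim: s P => [|h s IHs] P iP //=; rewrite inE.
case/predU1P => [->|fs] Na; last by apply: IHs => //; exact: add_scale_ideal.
by apply: quot_ideal_base => //; apply: ideal_addr => //; exists a.
Qed.

Lemma quot_ideal_sub N P s J : is_ideal J -> P `<=` J ->
  (forall f a, f \in s -> N a -> J (f * a)) -> quot_ideal N P s `<=` J.
Proof.
move=> iJ; elim: s P => [|f s IHs] P PJ sJ //=; apply: IHs.
  by apply: ideal_add_sub => // _ [a Na <-]; apply: sJ => //; exact: mem_head.
by move=> h a hs; apply: sJ; rewrite inE hs orbT.
Qed.

Lemma quot_idealE N P s : is_ideal N -> is_ideal P ->
  ideal_add P (ideal_mul (ideal_gen [set` s]) N) = quot_ideal N P s.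
Proof.
move=> iN iP; have iQ := quot_ideal_ideal s iN iP.
have iM : is_ideal (ideal_mul (ideal_gen [set` s]) N) by exact: ideal_gen_ideal.
apply/seteqP; split.
  apply: ideal_add_sub => //; first exact: quot_ideal_base.
  apply: ideal_gen_sub => // _ [f sf [a Na <-]].
  apply: (sf [set f | forall a, N a -> quot_ideal N P s (f * a)]) => //.
  split=> [|h /= hs b Nb]; last exact: quot_ideal_mem.
  split=> [b Nb|g h hg hh b Nb|r g hg b Nb]; first by rewrite mul0r; exact: ideal0.
    by rewrite mulrDl; apply: idealD => //; [exact: hg|exact: hh].
  by rewrite -mulrA; apply: idealMl => //; exact: hg.
apply: quot_ideal_sub; [exact: ideal_add_ideal|exact: ideal_addl|].
move=> f a fs Na; apply: ideal_addr => //; apply: sub_ideal_gen.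
by exists f; [exact: sub_ideal_gen|exists a].
Qed.

Lemma regular_seqE N P s : is_ideal N -> is_ideal P ->
  regular_seq N P s <-> regular_list N P s /\ ~ (N `<=` quot_ideal N P s).
Proof.
move=> iN iP; rewrite /regular_seq quot_idealE // take_size.
suff -> : (forall i, (i < size s)%N -> forall a, N a ->
  ideal_add P (ideal_mul (ideal_gen [set` take i s]) N) (nth 0 s i * a) ->
  ideal_add P (ideal_mul (ideal_gen [set` take i s]) N) a) <-> regular_list N P s by [].
transitivity (forall i, (i < size s)%N -> nzd_on N (quot_ideal N P (take i s)) (nth 0 s i)).
  split=> h i lti a Na; first by rewrite -!quot_idealE //; exact: h.
  by rewrite !quot_idealE //; exact: h.
elim: s P iP => [|f s IHs] P iP /=; first by split.
rewrite -IHs; last exact: add_scale_ideal.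
split=> [h|[h0 h] [|i]] //; last exact: h.
by split=> [|i lti]; [exact: (h 0%N)|exact: (h i.+1)].
Qed.

Lemma kacyclic_of_regular n (x : 'I_n -> R) N P s : is_ideal N -> is_ideal P ->
  (forall f, f \in s -> generated_by_x x f) -> regular_list N P s ->
  forall i, (i < size s)%N -> kacyclic x N P i.
Proof.
move=> iN; elim: s P => [|f s IHs] P iP //= ms [nzf regs] i lti.
apply: (kacyclic_of_nzd iN iP _ nzf); first by apply: ms; exact: mem_head.
case: i lti => // i lti; apply: IHs => //; first exact: add_scale_ideal.
by move=> g gs; apply: ms; rewrite inE gs orbT.
Qed.

End RegularLists.

(** * Dickson's lemma and noetherianity of polynomial rings *)

Section Dickson.
Variable n : nat.
Implicit Types (a b : 'X_{1..n}) (U : set 'X_{1..n}).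

Definition upset U : Prop := forall a b, (a <= b)%MM -> U a -> U b.

Definition truncm (g : nat) a : 'X_{1..n} := [multinom minn (a i) g | i < n].

Lemma truncm_le g a : (truncm g a <= a)%MM.
Proof. by apply/mnm_lepP => i; rewrite mnmE geq_minl. Qed.

(** Only finitely many exponents lie in the box, so an increasing family of sets
    is stationary there. *)
Lemma truncm_uniform g (Q : nat -> set 'X_{1..n}) :
  (forall k l, (k <= l)%N -> Q k `<=` Q l) ->
  exists K, forall a, (exists k, Q k (truncm g a)) -> Q K (truncm g a).
Proof.
move=> Qmono; pose mk (f : {ffun 'I_n -> 'I_g.+1}) : 'X_{1..n} := [multinom (f i : nat) | i < n].
have /choice[v hv] f : exists k, (exists k', Q k' (mk f)) -> Q k (mk f).
  by have [[k Qk]|nQ] := pselect (exists k, Q k (mk f)); [exists k|exists 0%N].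
exists (\max_f v f) => a Qa.
have aE : truncm g a = mk [ffun i => inord (minn (a i) g)].
  by apply/mnmP => i; rewrite !mnmE ffunE inordK // ltnS geq_minr.
rewrite aE in Qa *; apply: Qmono (hv _ Qa).
exact: leq_bigmax.
Qed.

Let setm a j v : 'X_{1..n} := [multinom if i == j then v else a i | i < n].

(** Induction on the number of coordinates on which [U] depends: the slices of
    [U] at the values [v] of a coordinate increase with [v], and they are
    constant from some value [C] on because their union is decided in a box. *)
Lemma upset_truncm_on (W : seq 'I_n) U : upset U ->
  (forall a b, (forall i, i \in W -> a i = b i) -> U a -> U b) ->
  exists g, forall a, U a -> U (truncm g a).
Proof.
elim: W U => [|j W IHW] U upU depU.
  by exists 0%N => a; apply: depU => i; rewrite in_nil.
have up_set v a b : (a <= b)%MM -> U (setm a j v) -> U (setm b j v).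
  move=> /mnm_lepP ab; apply: upU; apply/mnm_lepP => i; rewrite !mnmE.
  by case: ifP.
have dep_set v a b : (forall i, i \in W -> a i = b i) -> U (setm a j v) -> U (setm b j v).
  move=> ab; apply: depU => i; rewrite !mnmE inE; case: eqP => //= _; exact: ab.
have /choice[gv gvP] v : exists g, forall a, U (setm a j v) -> U (setm (truncm g a) j v).
  by apply: (IHW (fun a => U (setm a j v))); [exact: up_set|exact: dep_set].
have [g1 g1P] : exists g, forall a, (exists v, U (setm a j v)) ->
    exists v, U (setm (truncm g a) j v).
  apply: (IHW (fun a => exists v, U (setm a j v))).
    by move=> a b ab [v]; exists v; exact: (up_set v a b ab).
  by move=> a b ab [v]; exists v; exact: (dep_set v a b ab).
have [|C CP] := @truncm_uniform g1 (fun v a => U (setm a j v)).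
  move=> k l kl a; apply: upU; apply/mnm_lepP => i; rewrite !mnmE.
  by case: ifP.
exists (maxn C (\max_(v < C.+1) gv v)) => a Ua.
have aE : setm a j (a j) = a.
  by apply/mnmP => i; rewrite mnmE; case: eqP => [->|].
pose v := minn (a j) C.
have Uv : U (setm a j v).
  rewrite /v; case: (leqP (a j) C) => [_|_]; first by rewrite aE.
  apply: up_set (truncm_le g1 a) _; apply: CP; apply: g1P.
  by exists (a j); rewrite aE.
apply: upU (gvP _ _ Uv); apply/mnm_lepP => i; rewrite !mnmE.
case: eqP => [->|_]; first by rewrite leq_min geq_minl /= leq_max geq_minr.
rewrite leq_min geq_minl /= geq_min orbC leq_max orbC.
have vC : (v < C.+1)%N by rewrite ltnS geq_minr.
have vM : (gv v <= \max_(w < C.+1) gv w)%N.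
  exact: (leq_bigmax (F := fun w : 'I_C.+1 => gv w) (Ordinal vC)).
by rewrite vM !orbT.
Qed.

(** Dickson's lemma, in the form: membership in an up-closed set of exponents
    is decided inside a finite box. *)
Lemma upset_truncm U : upset U -> exists g, forall a, U (truncm g a) <-> U a.
Proof.
move=> upU; have [|g gP] := upset_truncm_on (W := enum 'I_n) upU.
  move=> a b ab; have -> // : a = b; apply/mnmP => i; apply: ab.
  by rewrite mem_enum.
exists g => a; split; last exact: gP.
exact/upU/truncm_le.
Qed.

End Dickson.

(** The maximal condition on ideals. *)
Definition noetherian (R : comNzRingType) : Prop :=
  forall F : set (set R), (exists I, F I) -> (forall I, F I -> is_ideal I) ->
  exists2 I, F I & forall J, F J -> I `<=` J -> J `<=` I.

Section NoetherianPolynomials.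
Variables (K : fieldType) (n : nat).
Local Notation S := {mpoly K[n]}.
Implicit Types (I J : set S).

Definition lead_set I : set 'X_{1..n} :=
  [set a | exists2 f, I f & f != 0 /\ mlead f = a].

Lemma lead_set_upset I : is_ideal I -> upset (lead_set I).
Proof.
move=> iI a b ab [f If [f0 fa]]; exists ('X_[b - a] * f); first exact: idealMl.
have X0 : 'X_[b - a] != 0 :> S by rewrite -msupp_eq0 msuppX.
by split; [rewrite mulf_neq0|rewrite mleadM // mleadXm fa submK].
Qed.

(** Division by the elements of [I] cancels the leading terms of [J] one after
    the other, and the monomial order is well-founded. *)
Lemma lead_set_sub I J : is_ideal I -> is_ideal J -> I `<=` J ->
  lead_set J `<=` lead_set I -> J `<=` I.
Proof.
move=> iI iJ IJ leadJI.
suff h a f : mlead f = a -> J f -> I f by move=> f; exact: h.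
elim/(well_founded_ind (@ltom_wf n)): a f => a IHa f fa Jf.
have [->|f0] := eqVneq f 0; first exact: ideal0.
have [|h Ih [h0 hf]] := leadJI (mlead f); first by exists f.
pose c := mleadc f / mleadc h.
have Ich : I (c *: h) by rewrite -mul_mpolyC; exact: idealMl.
apply: (idealDr iI (b := - (c *: h))); first exact: idealN.
have [->|f'0] := eqVneq (f - c *: h) 0; first exact: ideal0.
apply: (IHa (mlead (f - c *: h))) => //; last by apply: idealB => //; exact: IJ.
rewrite lt_neqAle; apply/andP; split.
  apply: contraNneq f'0 => f'a; rewrite -mleadc_eq0 f'a -fa mcoeffB mcoeffZ.
  by rewrite /c -hf divfK ?subrr // hf -hf mleadc_eq0.
apply: le_trans (mleadB_le _ _) _; rewrite leUx -fa lexx /=.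
by apply: le_trans (mleadZ_le _ _) _; rewrite hf.
Qed.

(** Along a strictly increasing chain of ideals the sets of leading exponents
    would increase too, which Dickson's lemma excludes. *)
Lemma mpoly_noetherian : noetherian S.
Proof.
move=> F [I0 FI0] Fid; apply: contrapT => nomax.
have /choice[next nextP] (I : {I | F I}) :
    exists J : {I | F I}, sval I `<=` sval J /\ ~ (sval J `<=` sval I).
  case: I => I FI /=; apply: contrapT => noJ; apply: nomax; exists I => // J FJ IJ.
  by apply: contrapT => JI; apply: noJ; exists (exist _ J FJ).
pose C k := iter k next (exist _ I0 FI0).
have Cid k : is_ideal (sval (C k)) by apply: Fid; case: (C k).
have Cmono k l : (k <= l)%N -> sval (C k) `<=` sval (C l).
  move=> /subnK <-; elim: (l - k)%N => [|m IHm] //=.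
  by apply: subset_trans IHm _; have [] := nextP (C (m + k)%N).
have leadmono k l : (k <= l)%N -> lead_set (sval (C k)) `<=` lead_set (sval (C l)).
  by move=> /Cmono kl a [f /kl]; exists f.
pose U a := exists k, lead_set (sval (C k)) a.
have upU : upset U.
  by move=> a b ab [k ka]; exists k; apply: lead_set_upset ab ka.
have [g gP] := upset_truncm upU.
have [k kP] := truncm_uniform g leadmono.
have [_] := nextP (C k); apply.
apply: (lead_set_sub (Cid k) (Cid k.+1) (Cmono _ _ (leqnSn k))) => a ka.
apply: (lead_set_upset (Cid k) (truncm_le g a)); apply: kP.
by apply/gP; exists k.+1.
Qed.

End NoetherianPolynomials.

(** * Regular elements exist when there is no socle *)

Section RegularElement.
Variables (R : comNzRingType) (n : nat) (x : 'I_n -> R) (N P : set R).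
Hypotheses (noethR : noetherian R) (iN : is_ideal N) (iP : is_ideal P).

Let ann a : set R := [set r | P (r * a)].

Let ann_ideal a : is_ideal (ann a).
Proof.
split=> [|r s|r s]; rewrite /ann /= ?mul0r; first exact: ideal0.
  by rewrite mulrDl; exact: idealD.
by rewrite -mulrA; exact: idealMl.
Qed.

Let maxann a := [/\ N a, ~ P a &
  forall b, N b -> ~ P b -> ann a `<=` ann b -> ann b `<=` ann a].

Let exists_maxann a : N a -> ~ P a -> exists2 b, maxann b & ann a `<=` ann b.
Proof.
move=> Na Pa; have [||I [b [Nb Pb ab] <-] maxb] := noethR
  (F := [set I | exists2 b, [/\ N b, ~ P b & ann a `<=` ann b] & ann b = I]).
- by exists (ann a); exists a => //; split.
- by move=> _ [b _ <-]; exact: ann_ideal.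
exists b => //; split=> // c Nc Pc bc; apply: maxb => //.
by exists c => //; split=> //; exact: subset_trans bc.
Qed.

(** A maximal annihilator is a prime ideal. *)
Let maxann_prime a r s : maxann a -> P (r * s * a) -> P (r * a) \/ P (s * a).
Proof.
move=> [Na Pa maxa] Prs; have [|nPs] := pselect (P (s * a)); [by right|left].
apply: (maxa (s * a)) => //; first exact: idealMl.
  by move=> t; rewrite /ann /= mulrCA => ta; exact: idealMl.
by rewrite /ann /= mulrA.
Qed.

(** A prime ideal that contains none of finitely many ideals does not contain
    their product. *)
Let separate a (l : seq R) : maxann a ->
  (forall b, b \in l -> exists2 r, P (r * b) & ~ P (r * a)) ->
  exists2 r, (forall b, b \in l -> P (r * b)) & ~ P (r * a).
Proof.
move=> maxa; elim: l => [|b l IHl] h; first by exists 1; rewrite ?mul1r //; case: maxa.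
have [r rl ra] := IHl (fun c cl => h c (mem_behead (s := b :: l) cl)).
have [s sb sa] := h b (mem_head _ _).
exists (r * s); last by move=> /(maxann_prime maxa)[].
move=> c; rewrite inE => /predU1P[->|cl]; first by rewrite -mulrA; exact: idealMl.
by rewrite mulrAC; apply: idealMr => //; exact: rl.
Qed.

(** There are finitely many maximal annihilators: by noetherianity finitely many
    of the elements that define them generate all the others, and a prime
    containing an intersection contains one of its terms. *)
Let finite_maxann : exists2 l : seq R, (forall b, b \in l -> maxann b) &
  forall a, maxann a -> exists2 b, b \in l & ann b `<=` ann a.
Proof.
have iT := is_ideal_setT R.
have [||I [l maxl <-] lP] := noethR (F := [set I | exists2 l : seq R,
    (forall b, b \in l -> maxann b) & quot_ideal setT P l = I]).
- by exists P, [::].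
- by move=> _ [l _ <-]; exact: quot_ideal_ideal.
exists l => // a maxa; apply: contrapT => nob.
have [|r rl ra] := separate (l := l) maxa.
  move=> b bl; apply: contrapT => nor; apply: nob; exists b => // r rb.
  by apply: contrapT => ra; apply: nor; exists r.
have la : quot_ideal setT P l a.
  apply: (lP (quot_ideal setT P (a :: l))).
  - by exists (a :: l) => // b; rewrite inE => /predU1P[->|/maxl].
  - apply: quot_ideal_sub; [exact: quot_ideal_ideal|exact: quot_ideal_base|].
    by move=> f b fl _; apply: quot_ideal_mem => //; rewrite inE fl orbT.
  - by rewrite -[X in quot_ideal _ _ _ X]mulr1; apply: quot_ideal_mem => //; exact: mem_head.
apply: ra; apply: (quot_ideal_sub (J := [set b | P (r * b)])) la => [|b Pb|f b fl _].
- split=> [|b c|s b]; rewrite /= ?mulr0 ?mulrDr; first exact: ideal0.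
    exact: idealD.
  by rewrite mulrCA; exact: idealMl.
- exact: idealMl.
- by rewrite /= mulrA; apply: idealMr => //; exact: rl.
Qed.

(** Prime avoidance for the maximal annihilators. *)
Let avoid (l : seq R) : (forall b, b \in l -> maxann b) ->
  (forall b, b \in l -> exists j, ~ P (x j * b)) ->
  exists2 f, generated_by_x x f & forall b, b \in l -> ~ P (f * b).
Proof.
elim: l => [|a l IHl] maxl hl.
  by exists 0 => //; exists (fun=> 0); rewrite big1 // => j _; rewrite mul0r.
have inl b : b \in l -> b \in a :: l by rewrite inE orbC => ->.
have [f [g fE] fl] := IHl (fun b bl => maxl b (inl b bl)) (fun b bl => hl b (inl b bl)).
have maxa := maxl a (mem_head _ _).
have [fa|fa] := pselect (P (f * a)); last first.
  by exists f; [exists g|move=> b; rewrite inE => /predU1P[->|/fl]].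
have [|r rl ra] := separate (l := l) maxa.
  move=> b bl; apply: contrapT => nor; apply: (fl b bl).
  have [Nb Pb maxb] := maxl b (inl b bl); have [Na Pa _] := maxa.
  apply: (maxb a) => // r rb.
  by apply: contrapT => ra; apply: nor; exists r.
have [j ja] := hl a (mem_head _ _).
exists (f + r * x j).
  exists (fun k => g k + (if k == j then r else 0)).
  rewrite fE (bigD1 j) //= [in RHS](bigD1 j) //= eqxx mulrDl addrAC.
  by congr (_ + _); apply: eq_bigr => k /negbTE ->; rewrite addr0.
move=> b; rewrite inE => /predU1P[->|bl]; rewrite mulrDl => h.
  have /(maxann_prime maxa)[|] // : P (r * x j * a).
  by apply: (idealDr iP (b := f * a)) => //; rewrite addrC.
apply: (fl b bl); apply: (idealDr iP) h.
by rewrite mulrAC; apply: idealMr => //; exact: rl.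
Qed.

(** Kaplansky's argument: the zero divisors on [N / P] are the elements of the
    finitely many maximal annihilators. None of these primes contains [(x)],
    as its defining element would lie in the socle, so prime avoidance applies. *)
Lemma exists_nzd : (forall a, N a -> (forall j, P (x j * a)) -> P a) ->
  exists2 f, generated_by_x x f & nzd_on N P f.
Proof.
move=> soc; have [l maxl lP] := finite_maxann.
have [|f fm fl] := avoid maxl.
  move=> b /maxl[Nb Pb _]; apply: contrapT => noj; apply: Pb; apply: soc => // j.
  by apply: contrapT => jb; apply: noj; exists j.
exists f => // b Nb fb; apply: contrapT => Pb.
have [a maxa ba] := exists_maxann Nb Pb; have [Na Pa _] := maxa.
have [c cl ca] := lP a maxa; apply: (fl c cl).
by have [_ _ maxc] := maxl c cl; apply: maxc ca _ _ => //; exact: ba.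
Qed.

End RegularElement.

(** * Depth and Koszul cohomology *)

Lemma nat_maxP (A : set nat) (n : nat) :
  (exists k, A k) -> (forall k, A k -> (k <= n)%N) ->
  A (nat_max A) /\ forall k, A k -> (k <= nat_max A)%N.
Proof.
move=> [k Ak] An.
have exA : exists k, `[< A k >] by exists k; exact/asboolP.
have bA k' : `[< A k' >] -> (k' <= n)%N by move/asboolP/An.
have [AM uM] : (A `&` ubound A) (nat_max A); last by split=> // k' /uM.
apply: xgetPex; case: (ex_maxnP exA bA) => m /asboolP Am mP.
by exists m; split=> // k' Ak'; rewrite leEnat; apply/mP/asboolP.
Qed.

Section Depth.
Variables (K : fieldType) (n : nat).
Local Notation S := {mpoly K[n]}.
Local Notation x := (fun j : 'I_n => 'X_j : S).
Implicit Types (I J N P : set S) (s : seq S).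

Lemma irrelevantE (f : S) : irrelevant_ideal f <-> generated_by_x x f.
Proof.
split.
  apply: ideal_gen_sub => [|_ [j _ <-]].
    split=> [|_ _ [g ->] [h ->]|r _ [g ->]].
    - by exists (fun=> 0); rewrite big1 // => j _; rewrite mul0r.
    - exists (fun j => g j + h j); rewrite -big_split /=.
      by apply: eq_bigr => j _; rewrite mulrDl.
    - exists (fun j => r * g j); rewrite mulr_sumr.
      by apply: eq_bigr => j _; rewrite mulrA.
  exists (fun k => (k == j)%:R); rewrite (bigD1 j) //= eqxx mul1r big1 ?addr0 //.
  by move=> k /negbTE ->; rewrite mul0r.
have iM : is_ideal (@irrelevant_ideal K n) by exact: ideal_gen_ideal.
move=> [g ->]; apply: ideal_sum => // j _; apply: (idealMl _ iM).
by apply: sub_ideal_gen; exists j.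
Qed.

Lemma mem_irrelevant_X j : generated_by_x x 'X_j.
Proof. by apply/irrelevantE; apply: sub_ideal_gen; exists j. Qed.

(** The product of the ideal of the variables and [I]. *)
Definition irrelevant_mul I : set S :=
  [set a | exists2 b : 'I_n -> S, forall j, I (b j) & a = \sum_j b j * 'X_j].

Lemma irrelevant_mul_ideal I : is_ideal I -> is_ideal (irrelevant_mul I).
Proof.
move=> iI; split=> [|_ _ [b Ib ->] [c Ic ->]|r _ [b Ib ->]].
- exists (fun=> 0) => [j|]; first exact: ideal0.
  by rewrite big1 // => j _; rewrite mul0r.
- exists (fun j => b j + c j) => [j|]; first exact: idealD.
  by rewrite -big_split /=; apply: eq_bigr => j _; rewrite mulrDl.
- exists (fun j => r * b j) => [j|]; first exact: idealMl.
  by rewrite mulr_sumr; apply: eq_bigr => j _; rewrite mulrA.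
Qed.

(** Nakayama's lemma for the ideal of the variables: by degree, as [I = m I]
    would force every element of [I] to have arbitrarily large order. *)
Lemma irrelevant_mul_proper I : I `<=` irrelevant_mul I -> I `<=` [set 0].
Proof.
move=> ImI.
suff ord D a m : I a -> m \in msupp a -> (D <= mdeg m)%N.
  move=> a Ia /=; apply/eqP; apply: contraT => a0.
  by have := ord (mdeg (mlead a)).+1 a _ Ia (mlead_supp a0); rewrite ltnn.
elim: D a m => // D IHD a m /ImI[b Ib ->]; rewrite mcoeff_msupp => am.
have [j] : exists j, m \in msupp (b j * 'X_j).
  apply: contrapT => nj; case/negP: am; rewrite raddf_sum /= big1 // => j _.
  by apply/eqP; rewrite -[_ == 0]negbK -mcoeff_msupp; apply/negP => mj; apply: nj; exists j.
case/msuppM_le/allpairsP => -[m1 m2] /= [m1b].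
rewrite msuppX inE => /eqP -> ->; rewrite mdegD mdeg1 addn1 ltnS.
exact: IHD (Ib j) m1b.
Qed.

Lemma quot_ideal_irrelevant I s : is_ideal I ->
  (forall f, f \in s -> generated_by_x x f) ->
  quot_ideal I [set 0] s `<=` irrelevant_mul I.
Proof.
move=> iI ms; have iM := irrelevant_mul_ideal iI.
apply: quot_ideal_sub => // [_ ->|f a fs Ia]; first exact: ideal0.
have [g ->] := ms f fs; exists (fun j => g j * a) => [j|]; first exact: idealMl.
by rewrite mulr_suml; apply: eq_bigr => j _; rewrite mulrAC.
Qed.

(** In the top degree every cochain is a cocycle, and the cohomology is [I / m I]. *)
Lemma top_not_kacyclic I : is_ideal I -> ~ (I `<=` [set 0]) ->
  ~ kacyclic x I [set 0] n.
Proof.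
move=> iI I0 acy; apply/I0/irrelevant_mul_proper => a Ia.
have [//||b Ib bE] := acy (fun=> a).
  by move=> A An; have := max_card (mem A); rewrite card_ord An ltnn.
have /eqP : a - kdiff x b [set: 'I_n]%SET = 0 by apply: bE; rewrite cardsT card_ord.
rewrite subr_eq0 => /eqP ->.
exists (fun j => ksign S j [set: 'I_n]%SET * b ([set: 'I_n] :\ j)%SET) => [j|].
  exact: idealMl.
by rewrite /kdiff; apply: eq_big => [j|j _]; [rewrite finset.inE|rewrite mulrAC].
Qed.

(** Converse of [kacyclic_of_regular]: vanishing in degree 0 says that the
    module has no socle, hence a regular element, and dividing by it shifts the
    vanishing range by one. *)
Lemma regular_of_kacyclic N P d : is_ideal N -> is_ideal P ->
  (forall i, (i < d)%N -> kacyclic x N P i) ->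
  exists s, [/\ size s = d, forall f, f \in s -> generated_by_x x f
              & regular_list N P s].
Proof.
move=> iN; elim: d P => [|d IHd] P iP acy; first by exists [::].
have [|f fm nzf] := @exists_nzd _ _ x N P (@mpoly_noetherian K n) iN iP.
  move=> a Na soc; have [//||b _ bE] := acy 0%N isT (fun=> a).
    move=> A A1; rewrite /kdiff; apply: ideal_sum => // j _.
    by rewrite -mulrA; apply: idealMl.
  by have := bE finset.set0 (cards0 _); rewrite kdiff_set0 subr0.
have [||s [ss ms rs]] := IHd (ideal_add P (scale_set f N)).
- exact: add_scale_ideal.
- by move=> i ltid; apply: kacyclic_quotient => //; apply: acy => //; exact: leqW.
exists (f :: s); split=> //=; first by rewrite ss.
by move=> g; rewrite inE => /predU1P[->|/ms].
Qed.

(** Regular sequences are hard to carry from one ideal to another; the vanishing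
    of Koszul cohomology, which is equivalent, follows exact sequences. *)
Lemma leq_depthP I d : is_ideal I -> ~ (I `<=` [set 0]) ->
  (d <= depth I)%N <-> forall i, (i < d)%N -> kacyclic x I [set 0] i.
Proof.
move=> iI I0; have i0 := is_ideal_set0 S.
pose D := [set d | exists s : seq S, [/\ size s = d,
  forall f, f \in s -> irrelevant_ideal f & regular_seq I [set 0] s]].
have DE k : D k <-> forall i, (i < k)%N -> kacyclic x I [set 0] i.
  split=> [[s [<- ms /(regular_seqE s iI i0)[rs _]]]|].
    by apply: kacyclic_of_regular => // f /ms/irrelevantE.
  move=> /(regular_of_kacyclic iI i0)[s [sk ms rs]]; exists s; split=> //.
    by move=> f /ms/irrelevantE.
  apply/(regular_seqE s iI i0); split=> // Iq; apply/I0/irrelevant_mul_proper.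
  by apply: subset_trans Iq _; exact: quot_ideal_irrelevant.
have [||Dmax Dub] := @nat_maxP D n.
- by exists 0%N; apply/DE.
- move=> k /DE acy; rewrite leqNgt; apply/negP => /acy.
  exact: top_not_kacyclic.
split=> [ld i lti|acy]; last by apply/Dub/DE.
by move/DE: Dmax; apply; exact: leq_trans lti ld.
Qed.

Lemma depth_leq_dim I : is_ideal I -> ~ (I `<=` [set 0]) -> (depth I <= n)%N.
Proof.
move=> iI I0; rewrite leqNgt; apply/negP => /(leq_depthP _ iI I0) acy.
exact: (top_not_kacyclic iI I0 (acy _ (ltnSn n))).
Qed.

End Depth.

(** * Monomial ideals as up-closed sets of exponents *)

Section MonomialIdealTheory.
Variables (K : fieldType) (n : nat).
Local Notation S := {mpoly K[n]}.
Implicit Types (I J : set S) (U V : set 'X_{1..n}) (f : S).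

Definition mono U : set S := [set f | forall a, a \in msupp f -> U a].

Lemma mono_ideal U : upset U -> is_ideal (mono U).
Proof.
move=> upU; split=> [a|f g fU gU a|r f fU a]; first by rewrite msupp0.
  by move=> /msuppD_le; rewrite mem_cat => /orP[/fU|/gU].
by move=> /msuppM_le/allpairsP[[b c] /= [_ /fU Uc ->]]; apply: upU Uc; exact: lem_addl.
Qed.

Lemma mono_X U a : mono U 'X_[a] <-> U a.
Proof.
split=> [h|Ua b]; first by apply: h; rewrite msuppX mem_head.
by rewrite msuppX inE => /eqP ->.
Qed.

Lemma mono_sub U I : is_ideal I -> (forall a, U a -> I 'X_[a]) -> mono U `<=` I.
Proof.
move=> iI UI f fU; rewrite [f]mpolyE big_seq; apply: ideal_sum => // a /fU Ua.
by rewrite -mul_mpolyC; apply: idealMl => //; exact: UI.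
Qed.

Definition up_closure (G : set 'X_{1..n}) : set 'X_{1..n} :=
  [set b | exists2 a, G a & (a <= b)%MM].

Lemma up_closure_upset G : upset (up_closure G).
Proof. by move=> a b ab [c Gc ca]; exists c => //; exact: lepm_trans ca ab. Qed.

Lemma ideal_gen_monomials (G : set 'X_{1..n}) :
  ideal_gen [set 'X_[a] | a in G] = mono (up_closure G).
Proof.
have iG := ideal_gen_ideal [set ('X_[a] : S) | a in G].
apply/seteqP; split.
  apply: ideal_gen_sub; first exact/mono_ideal/up_closure_upset.
  by move=> _ [a Ga <-]; apply/mono_X; exists a => //; exact: lepm_refl.
apply: mono_sub => // b [a Ga ab].
rewrite -(submK ab) mpolyXD; apply: (idealMl _ iG).
by apply: sub_ideal_gen; exists a.
Qed.

Lemma up_closure_id U : upset U -> up_closure U = U.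
Proof.
move=> upU; apply/seteqP; split=> [b [a Ua ab]|a Ua]; first exact: (upU a b).
by exists a => //; exact: lepm_refl.
Qed.

Lemma monomial_idealP I : monomial_ideal I <-> exists2 U, upset U & I = mono U.
Proof.
split=> [[G ->]|[U upU ->]].
  by exists (up_closure G); [exact: up_closure_upset|exact: ideal_gen_monomials].
by exists U; rewrite ideal_gen_monomials up_closure_id.
Qed.

Lemma proper_nz_monomial_idealP I : proper_nz_monomial_ideal I <->
  exists U, [/\ upset U, I = mono U, exists a, U a & ~ U 0%MM].
Proof.
split=> [[/monomial_idealP[U upU IU] I0 IT]|[U [upU -> [a Ua] U0]]].
  exists U; split=> //.
    apply: contrapT => nU; apply: I0; rewrite IU; apply/seteqP; split=> [f fU|_ ->].
      apply/eqP; apply: contraT => f0; exfalso; apply: nU.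
      by exists (mlead f); apply: fU; exact: mlead_supp.
    exact: (ideal0 (mono_ideal upU)).
  move=> U0; apply: IT; rewrite IU; apply/seteqP; split=> // f _ a _.
  by apply: upU U0; apply/mnm_lepP => i; rewrite mnm0E.
split; first by apply/monomial_idealP; exists U.
  move=> U0'; have /mono_X : U a by []; rewrite U0' /= => /eqP.
  by rewrite -msupp_eq0 msuppX.
by move=> UT; apply: U0; apply/mono_X; rewrite UT.
Qed.

Lemma mono_add U V : upset U -> upset V ->
  ideal_add (mono U) (mono V) = mono (U `|` V).
Proof.
move=> upU upV; have iU := mono_ideal upU; have iV := mono_ideal upV.
have upUV : upset (U `|` V).
  by move=> a b ab [/(upU _ _ ab)|/(upV _ _ ab)]; [left|right].
apply/seteqP; split.
  by apply: ideal_add_sub; [exact: mono_ideal|move=> f fU a /fU; left|move=> f fV a /fV; right].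
apply: mono_sub => [|a [Ua|Va]]; first exact: ideal_add_ideal.
  by apply: ideal_addl => //; apply/mono_X.
by apply: ideal_addr => //; apply/mono_X.
Qed.

Lemma scale_setT_X (R : comNzRingType) (f : R) : scale_set f setT = ideal_gen [set f].
Proof.
apply/seteqP; split=> [_ [a _ <-]|].
  by apply: (idealMr _ (ideal_gen_ideal _)); exact: sub_ideal_gen.
apply: ideal_gen_sub; first by apply: scale_set_ideal; exact: is_ideal_setT.
by move=> _ ->; exists 1; rewrite ?mulr1.
Qed.

Lemma mono_scale a : scale_set ('X_[a] : S) setT = mono [set b | (a <= b)%MM].
Proof.
rewrite scale_setT_X; transitivity (ideal_gen [set ('X_[b] : S) | b in [set a]]).
  by congr ideal_gen; apply/seteqP; split=> [_ ->|_ [_ -> <-]] //; exists a.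
rewrite ideal_gen_monomials; congr mono; apply/seteqP; split=> [b [_ ->]|b ab] //.
by exists a.
Qed.

Lemma mono_set0 : mono set0 = [set (0 : S)].
Proof.
apply/seteqP; split=> [f f0|_ ->]; last by move=> a; rewrite msupp0.
apply/eqP; apply: contraT => fn0.
by case: (f0 _ (mlead_supp fn0)).
Qed.

Lemma mono_nonzero U a : U a -> ~ (mono U `<=` [set 0]).
Proof.
move=> /mono_X Ua U0; have /eqP := U0 _ Ua.
by rewrite -msupp_eq0 msuppX.
Qed.

Definition meets_support (W : {set 'I_n}) : set 'X_{1..n} :=
  [set a | exists2 i, i \in W & (0 < a i)%N].

(** [W] is the set of variables already divided out, for the induction on [s]. *)
Lemma variables_regular (W : {set 'I_n}) (s : seq 'I_n) :
  uniq s -> (forall j, j \in s -> j \notin W) ->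
  regular_list setT (mono (meets_support W)) [seq 'X_j | j <- s].
Proof.
elim: s W => [|j s IHs] W //= /andP[js us] sW; split.
  move=> f _ fW a af.
  have : (U_(j) + a)%MM \in msupp ('X_j * f).
    by rewrite mcoeff_msupp mulrC mcoeffMX -mcoeff_msupp.
  move=> /fW[i iW]; rewrite mnmDE mnm1E => ai; exists i => //.
  by move: ai; case: eqP => // ji; case/negP: (sW j (mem_head _ _)); rewrite ji.
rewrite mono_scale mono_add; first last.
- by move=> a b ab /= ja; exact: lepm_trans ja ab.
- by move=> a b /mnm_lepP ab [i ik ai]; exists i => //; exact: leq_trans (ab i).
rewrite (_ : setU _ _ = meets_support (j |: W)%SET).
  apply: IHs => // k ks; rewrite !inE negb_or sW ?inE ?ks ?orbT // andbT.
  by apply: contraNneq js => <-.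
apply/seteqP; split=> [a [[i iW ai]|/mnm_lepP /(_ j)]|a [i]].
- by exists i; rewrite // !inE iW orbT.
- by rewrite mnm1E eqxx => ja; exists j; rewrite // !inE eqxx.
- rewrite !inE => /predU1P[-> ja|iW ai]; [right|by left; exists i].
  by apply/mnm_lepP => k; rewrite mnm1E; case: eqP => // <-.
Qed.

Lemma kacyclic_ring i : (i < n)%N ->
  kacyclic (fun j : 'I_n => 'X_j : S) setT [set 0] i.
Proof.
move=> lti; have iT := is_ideal_setT S; have i0 := is_ideal_set0 S.
apply: (kacyclic_of_regular (s := [seq 'X_j | j <- enum 'I_n]) iT i0).
- by move=> _ /mapP[j _ ->]; exact: mem_irrelevant_X.
- have := @variables_regular finset.set0 (enum 'I_n) (enum_uniq _) _.
  rewrite (_ : meets_support _ = set0) ?mono_set0; last first.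
    by apply/seteqP; split=> [a [j]|//]; rewrite inE.
  by apply=> j _; rewrite inE.
- by rewrite size_map size_enum_ord.
Qed.

(** * Depth under sums and adjunction of a variable *)

(** The truncation at [n] comes from the cohomology of the polynomial ring
    itself, which is not 0 in degree [n]. *)
Lemma depth_add_nzd I f : is_ideal I -> ~ (I `<=` [set 0]) ->
  irrelevant_ideal f -> (forall a, I (f * a) -> I a) ->
  (minn (depth (ideal_add I (scale_set f setT))).+1 n <= depth I)%N.
Proof.
move=> iI I0 /irrelevantE mf nzf; set L := ideal_add _ _.
have iL : is_ideal L by apply: add_scale_ideal => //; exact: is_ideal_setT.
have L0 : ~ (L `<=` [set 0]).
  move=> L0; apply: I0; apply: subset_trans L0; apply: ideal_addl.
  by apply: scale_set_ideal; exact: is_ideal_setT.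
apply/(leq_depthP _ iI I0) => i; rewrite leq_min ltnS => /andP[lti ltin].
apply: (kacyclic_add_nzd iI mf nzf (@kacyclic_ring) _ lti ltin).
by apply/(leq_depthP _ iL L0).
Qed.

Lemma depth_add_regular I (s : seq S) : is_ideal I -> ~ (I `<=` [set 0]) ->
  (forall f, f \in s -> irrelevant_ideal f) -> regular_list setT I s ->
  (minn (depth (quot_ideal setT I s) + size s) n <= depth I)%N.
Proof.
elim: s I => [|f s IHs] I iI I0 ms /=; first by rewrite addn0 geq_minl.
move=> [nzf rs]; have iT := is_ideal_setT S.
have mf : irrelevant_ideal f by apply: ms; exact: mem_head.
have := depth_add_nzd iI I0 mf (fun a => nzf a Logic.I).
set L := ideal_add I _ in rs *.
have iL : is_ideal L by exact: add_scale_ideal.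
have L0 : ~ (L `<=` [set 0]).
  move=> L0; apply: I0; apply: subset_trans L0; apply: ideal_addl.
  exact: scale_set_ideal.
have {}IHs := IHs L iL L0 (fun g gs => ms g (mem_behead (s := f :: s) gs)) rs.
apply: leq_trans; rewrite leq_min geq_minr andbT addnS.
move: IHs; rewrite !geq_min ltnS => /orP[->//|h].
by rewrite (leqW h) orbT.
Qed.

Lemma depth_add_nzd_ge I f : is_ideal I -> ~ (I `<=` [set 0]) ->
  (forall a, I (f * a) -> I a) ->
  (depth I <= (depth (ideal_add I (scale_set f setT))).+1)%N.
Proof.
move=> iI I0 nzf; set L := ideal_add _ _.
have iL : is_ideal L by apply: add_scale_ideal => //; exact: is_ideal_setT.
have L0 : ~ (L `<=` [set 0]).
  move=> L0; apply: I0; apply: subset_trans L0; apply: ideal_addl.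
  by apply: scale_set_ideal; exact: is_ideal_setT.
have := depth_leq_dim iI I0; case dI: (depth I) => [|d] // ltdn; rewrite ltnS.
apply/(leq_depthP _ iL L0) => i lti.
apply: (kacyclic_add_nzd_ge iI nzf (@kacyclic_ring) _ lti); last exact: ltn_trans lti ltdn.
by apply/(leq_depthP _ iI I0); rewrite dI.
Qed.

(** With [X] the complement of [Y], the cocycle [d e_X] has values in [L], since
    its coefficients are variables in [Y]. Its primitives over the polynomial
    ring differ from [e_X] by coboundaries, hence have a unit as coefficient of
    [e_X], and none has values in [L]. *)
Lemma depth_of_variables (L : set S) (Y : {set 'I_n}) : is_ideal L -> ~ (L `<=` [set 0]) ->
  (forall f, L f -> f@_0 = 0) -> (0 < #|Y|)%N -> (forall j, j \in Y -> L 'X_j) ->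
  (depth L + #|Y| <= n.+1)%N.
Proof.
move=> iL L0 Lconst Y0 YL; rewrite leqNgt; apply/negP => ltd.
have Yn : (#|Y| <= n)%N by have := max_card (mem Y); rewrite card_ord.
pose x (j : 'I_n) : S := 'X_j.
have acyL : kacyclic x L [set 0] (n - #|Y|).+1.
  have [h _] := leq_depthP (depth L) iL L0; apply: (h (leqnn _)).
  by rewrite -(ltn_add2r #|Y|) addSn subnK.
(* [e] is the cochain [e_X] for the complement [X] of [Y]. *)
pose e (A : {set 'I_n}) : S := (A == ~: Y)%SET%:R.
have cX : #|(~: Y)%SET| = (n - #|Y|)%N by rewrite cardsCs finset.setCK card_ord.
have [A|A _|w Lw dw] := acyL (kdiff x e).
- apply: ideal_sum => // j jA; rewrite /e; case: eqP => [AX|_]; last first.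
    by rewrite mulr0; exact: ideal0.
  rewrite mulr1; apply: idealMl => //; apply: YL.
  by rewrite -[Y]finset.setCK -AX !inE eqxx.
- by rewrite /= kdiff_kdiff.
have [||A Ai|v _ ev] := @kacyclic_ring (n - #|Y|) _ (fun A => e A - w A) => //.
- by rewrite ltn_subrL Y0 (leq_trans Y0).
- by rewrite kdiffB; exact: dw.
have /(congr1 (fun f : S => f@_0)) := ev _ cX.
rewrite /= /e eqxx raddfB raddfB /= (Lconst _ (Lw _)) mcoeff0 rmorph1 subr0.
rewrite /kdiff raddf_sum /= big1 ?subr0 => [/eqP|j _]; first by rewrite oner_eq0.
by rewrite !rmorphM /= mcoeffX -mdeg_eq0 mdeg1 mulr0 mul0r.
Qed.

End MonomialIdealTheory.

Section AdjoinVariable.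
Variables (K : fieldType) (n : nat).
Local Notation S := {mpoly K[n]}.
Local Notation T := {mpoly K[n.+1]}.
Local Notation y := ('X_ord_max : T).
Implicit Types (I P : set S) (f : S) (r a : T).

Lemma mpoly_subring_ind k (Q : {mpoly K[k]} -> Prop) :
  (forall c, Q c%:MP) -> (forall j, Q 'X_j) ->
  (forall p q, Q p -> Q q -> Q (p + q)) ->
  (forall p q, Q p -> Q q -> Q (p * q)) -> forall p, Q p.
Proof.
move=> QC QX QD QM; elim/mpolyind => [|c m p _ _ Qp]; first by rewrite -mpolyC0; exact: QC.
apply: (QD _ _ _ Qp); rewrite -mul_mpolyC; apply: (QM _ _); first exact: QC.
rewrite mpolyXE_id; apply: (big_ind Q) => [|p' q'|i _]; [exact: (QC 1)|exact: QM|].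
elim: (m i) => [|e IHe]; first by rewrite expr0; exact: (QC 1).
by rewrite exprS; exact: QM.
Qed.

(** Substitution of 0 for the last variable [y]: it is left inverse to [mwiden],
    and [S[y]] splits as the image of [mwiden] plus the multiples of [y]. *)
Definition kill_last (p : T) : S :=
  p \mPo [tuple (if insub (val i) is Some j then 'X_j else 0 : S) | i < n.+1].

Lemma kill_last_is_rmorphism :
  [/\ forall p q, kill_last (p + q) = kill_last p + kill_last q,
      forall p q, kill_last (p * q) = kill_last p * kill_last q
    & forall c, kill_last c%:MP = c%:MP].
Proof.
split=> [p q|p q|c]; [exact: raddfD|exact: rmorphM|exact: comp_mpolyC].
Qed.

Let killD := let: And3 h _ _ := kill_last_is_rmorphism in h.
Let killM := let: And3 _ h _ := kill_last_is_rmorphism in h.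
Let killC := let: And3 _ _ h := kill_last_is_rmorphism in h.

Lemma kill_last_X (i : 'I_n.+1) :
  kill_last 'X_i = (if insub (val i) is Some j then 'X_j else 0).
Proof. by rewrite /kill_last comp_mpolyXU -tnth_nth tnth_mktuple. Qed.

Lemma kill_last_y : kill_last y = 0.
Proof. by rewrite kill_last_X insubF //= ltnn. Qed.

Lemma mwiden_Xi (j : 'I_n) : mwiden ('X_j : S) = 'X_(widen_ord (leqnSn n) j).
Proof. by rewrite mwidenX mnmwiden1. Qed.

Lemma mwidenK f : kill_last (mwiden f) = f.
Proof.
elim/mpoly_subring_ind: f => [c|j|p q hp hq|p q hp hq].
- by rewrite mwidenC killC.
- by rewrite mwiden_Xi kill_last_X insubT //= => lj; congr 'X_[U_(_)]; exact: val_inj.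
- by rewrite raddfD killD hp hq.
- by rewrite rmorphM killM hp hq.
Qed.

Lemma kill_last_div r : exists q, r = mwiden (kill_last r) + y * q.
Proof.
elim/mpoly_subring_ind: r => [c|i|p q [p' hp] [q' hq]|p q [p' hp] [q' hq]].
- by exists 0; rewrite killC mwidenC mulr0 addr0.
- rewrite kill_last_X; case: insubP => [j _ ij|ni].
    by exists 0; rewrite mulr0 addr0 mwiden_Xi; congr 'X_[U_(_)]%MM; apply: val_inj; rewrite /= ij.
  exists 1; rewrite mwiden0 add0r mulr1; congr 'X_[U_(_)]; apply: val_inj => /=.
  by apply/eqP; rewrite eqn_leq -ltnS ltn_ord leqNgt.
- by exists (p' + q'); rewrite killD mwidenD mulrDr addrACA -hp -hq.
- exists (p' * mwiden (kill_last q) + mwiden (kill_last p) * q' + y * p' * q').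
  by rewrite killM mwidenM {1}hp {1}hq; ring.
Qed.

Definition extend_ideal I : set T := ideal_gen [set mwiden f | f in I].

Lemma extend_ideal_ideal I : is_ideal (extend_ideal I).
Proof. exact: ideal_gen_ideal. Qed.

Lemma mwiden_extend I f : I f -> extend_ideal I (mwiden f).
Proof. by move=> If; apply: sub_ideal_gen; exists f. Qed.

Lemma kill_last_extend I a : is_ideal I -> extend_ideal I a -> I (kill_last a).
Proof.
move=> iI; apply: (ideal_gen_sub (J := [set a | I (kill_last a)])).
  split=> [|p q Ip Iq|r p Ip] /=.
  - by rewrite /kill_last raddf0; exact: ideal0.
  - by rewrite killD; exact: idealD.
  - by rewrite killM; exact: idealMl.
by move=> _ [f If <-]; rewrite /= mwidenK.
Qed.

(** The splitting of [S[y]] restricts to the extension of [I]. *)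
Lemma extend_ideal_div I a : is_ideal I -> extend_ideal I a ->
  exists2 b, extend_ideal I b & a = mwiden (kill_last a) + y * b.
Proof.
move=> iI; have iE := extend_ideal_ideal I.
suff h : extend_ideal I `<=` [set a | extend_ideal I a /\
    exists2 b, extend_ideal I b & a = mwiden (kill_last a) + y * b].
  by move=> /h[].
apply: ideal_gen_sub => [|_ [f If <-]]; last first.
  split; first exact: mwiden_extend.
  by exists 0; [exact: (ideal0 iE)|rewrite mwidenK mulr0 addr0].
split=> [|p q [Ep [b Eb pE]] [Eq [c Ec qE]]|r p [Ep [b Eb pE]]].
- split; first exact: (ideal0 iE).
  by exists 0; [exact: (ideal0 iE)|rewrite /kill_last !raddf0 mulr0 addr0].
- split; first exact: (idealD iE).
  exists (b + c); first exact: (idealD iE).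
  by rewrite killD mwidenD mulrDr addrACA -pE -qE.
- split; first exact: (idealMl _ iE).
  have [q rE] := kill_last_div r.
  exists (q * p + mwiden (kill_last r) * b).
    by apply: (idealD iE); exact: (idealMl _ iE).
  by rewrite killM mwidenM {1}rE {1}pE [in q * p]pE; ring.
Qed.

Lemma y_neq0 : y != 0.
Proof. by rewrite -msupp_eq0 msuppX. Qed.

Lemma extend_ideal_nzd_y I a : is_ideal I -> extend_ideal I (y * a) -> extend_ideal I a.
Proof.
move=> iI /(extend_ideal_div iI)[b Eb].
rewrite killM kill_last_y mul0r mwiden0 add0r => /(mulfI y_neq0) -> //.
Qed.

(** Modulo [y] the extension of [I] is [I], so a regular sequence on [I] is
    regular on the quotient by [y] of this extension. *)
Lemma regular_list_extend I P (P' : set T) (s : seq S) : is_ideal I ->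
  (forall a, extend_ideal I a -> P' a <-> P (kill_last a)) ->
  regular_list I P s -> regular_list (extend_ideal I) P' [seq mwiden f | f <- s].
Proof.
move=> iI; have iE := extend_ideal_ideal I.
elim: s P P' => [|f s IHs] P P' PP' //= [nzf rs]; split.
  move=> a Ea P'a; apply/PP' => //; apply: nzf; first exact: kill_last_extend.
  by rewrite -[f]mwidenK -killM; apply/PP' => //; exact: (idealMl _ iE).
apply: IHs rs => a Ea; split.
  move=> [p P'p [_ [b Eb <-] aE]]; have Ep : extend_ideal I p.
    by apply: (idealDr iE (b := mwiden f * b)); [exact: (idealMl _ iE)|rewrite aE].
  exists (kill_last p); first exact/PP'.
  exists (f * kill_last b); first by exists (kill_last b) => //; exact: kill_last_extend.
  by rewrite -aE killD killM mwidenK.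
move=> [p Pp [_ [b Ib <-] aE]].
exists (a - mwiden (f * b)); last first.
  exists (mwiden (f * b)); last by rewrite subrK.
  by exists (mwiden b); [exact: mwiden_extend|rewrite mwidenM].
apply/PP'; last by rewrite -mwidenN killD mwidenK -aE addrK.
by apply: (idealB iE) => //; apply: mwiden_extend; exact: idealMl.
Qed.

Lemma extend_ideal_nonzero I : ~ (I `<=` [set 0]) -> ~ (extend_ideal I `<=` [set 0]).
Proof.
move=> I0 E0; apply: I0 => f /mwiden_extend/E0 /= wf0.
by rewrite -[f]mwidenK wf0 /kill_last raddf0.
Qed.

(** Prepend [y] to a regular sequence on [I]. *)
Lemma depth_extend_ideal I : is_ideal I -> ~ (I `<=` [set 0]) ->
  (depth I < depth (extend_ideal I))%N.
Proof.
move=> iI I0; have iE := extend_ideal_ideal I; have E0 := extend_ideal_nonzero I0.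
have i0 := is_ideal_set0 S; have i0T := is_ideal_set0 T.
have [acy _] := leq_depthP (depth I) iI I0.
have [s [ss ms rs]] := regular_of_kacyclic iI i0 (acy (leqnn _)).
apply/(leq_depthP _ iE E0).
suff h i : (i < size (y :: [seq mwiden f | f <- s]))%N ->
    kacyclic (fun j : 'I_n.+1 => 'X_j : T) (extend_ideal I) [set 0] i.
  by move=> i lti; apply: h; rewrite /= size_map ss.
apply: kacyclic_of_regular => //.
  move=> f; rewrite inE => /predU1P[->|/mapP[g gs ->]]; first exact: mem_irrelevant_X.
  have [c ->] := ms g gs; rewrite rmorph_sum /=; apply/irrelevantE.
  have iM : is_ideal (@irrelevant_ideal K n.+1) by exact: ideal_gen_ideal.
  apply: ideal_sum => // j _; rewrite mwidenM mwiden_Xi; apply: (idealMl _ iM).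
  exact/irrelevantE/mem_irrelevant_X.
split; first by move=> a Ea /= /eqP; rewrite mulf_eq0 (negbTE y_neq0) => /eqP.
apply: (regular_list_extend iI _ rs) => a Ea; split.
  by move=> [_ -> [_ [b Eb <-] <-]]; rewrite add0r killM kill_last_y mul0r.
move=> ka0; have [b Eb aE] := extend_ideal_div iI Ea.
by exists 0 => //; exists a; [exists b|rewrite add0r] => //; rewrite aE ka0 mwiden0 add0r.
Qed.

Lemma ideal_adjoin_varE I :
  ideal_adjoin_var I = ideal_add (extend_ideal I) (scale_set y setT).
Proof.
have iE := extend_ideal_ideal I; have iY := ideal_gen_ideal [set y].
rewrite scale_setT_X; apply/seteqP; split.
  apply: ideal_gen_sub => [|f [[g Ig <-]|->]]; first exact: ideal_add_ideal.
    by apply: ideal_addl => //; exact: mwiden_extend.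
  by apply: ideal_addr => //; exact: sub_ideal_gen.
apply: ideal_add_sub; first exact: ideal_gen_ideal.
  by apply: ideal_gen_sub => [|f If]; [exact: ideal_gen_ideal|apply: sub_ideal_gen; left].
by apply: ideal_gen_sub => [|f ->]; [exact: ideal_gen_ideal|apply: sub_ideal_gen; right].
Qed.

(** Adjoining [y] to the ring raises the depth by at least 1, and adding [y] to
    the extended ideal lowers it by at most 1. *)
Lemma depth_adjoin_var I : is_ideal I -> ~ (I `<=` [set 0]) ->
  (depth I <= depth (ideal_adjoin_var I))%N.
Proof.
move=> iI I0; rewrite -ltnS; apply: leq_trans (depth_extend_ideal iI I0) _.
rewrite ideal_adjoin_varE; apply: depth_add_nzd_ge; [exact: extend_ideal_ideal|
  exact: extend_ideal_nonzero|move=> a; exact: extend_ideal_nzd_y].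
Qed.

End AdjoinVariable.

(** * Partitions of sets of exponents into Stanley pieces *)

Section StanleyPartitions.
Variable n : nat.
Implicit Types (a b m : 'X_{1..n}) (W A B C Z : {set 'I_n}) (U V : set 'X_{1..n}).

(** The exponents of [x^p.1 K[p.2]], looking only at the coordinates in [W]. *)
Definition in_piece W (p : 'X_{1..n} * {set 'I_n}) a : bool :=
  [forall i in W, if i \in p.2 then (p.1 i <= a i)%N else a i == p.1 i].

(** A partition of [U] over the coordinates in [W]: the count is 1 on [U] and 0
    elsewhere. Working over a subset of the coordinates lets partitions over
    disjoint subsets be multiplied, and counting turns unions and products of
    partitions into sums and products of numbers. *)
Definition has_partition W U d : Prop :=
  exists D : seq ('X_{1..n} * {set 'I_n}),
    (forall p, p \in D -> (d <= #|(p.2 :&: W)%SET|)%N) /\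
    (forall a, count (fun p => in_piece W p a) D = `[< U a >]).

Definition restrm W a : 'X_{1..n} := [multinom if i \in W then a i else 0%N | i < n].

Lemma restrm_le W a : (restrm W a <= a)%MM.
Proof. by apply/mnm_lepP => i; rewrite mnmE; case: ifP. Qed.

Lemma has_partition_le W U d e : (e <= d)%N -> has_partition W U d -> has_partition W U e.
Proof.
by move=> ed [D [dD cD]]; exists D; split=> // p /dD; exact: leq_trans.
Qed.

Lemma has_partition_ext W U V d :
  (forall a, U a <-> V a) -> has_partition W U d -> has_partition W V d.
Proof.
move=> UV [D [dD cD]]; exists D; split=> // a; rewrite cD; congr nat_of_bool.
exact/asbool_equiv_eq/UV.
Qed.

Lemma has_partition_empty W U d : (forall a, ~ U a) -> has_partition W U d.
Proof.
move=> U0; exists [::]; split=> // a; case: asboolP => // Ua.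
by case: (U0 a).
Qed.

Lemma has_partitionU W U V d : (forall a, U a -> V a -> False) ->
  has_partition W U d -> has_partition W V d -> has_partition W (U `|` V) d.
Proof.
move=> UV [D [dD cD]] [E [dE cE]]; exists (D ++ E); split=> [p|a].
  by rewrite mem_cat => /orP[/dD|/dE].
rewrite count_cat cD cE.
case: asboolP => Ua; case: asboolP => Va; [by case: (UV a)|..]; case: asboolP => //.
- by case; left.
- by case; right.
- by case.
Qed.

Lemma count_allpairs (S T X : Type) (f : S -> T -> X) (P : pred X) (A : pred S)
    (B : pred T) s t : (forall x y, P (f x y) = A x && B y) ->
  count P [seq f x y | x <- s, y <- t] = (count A s * count B t)%N.
Proof.
move=> PE; elim: s => //= x s IHs; rewrite count_cat IHs count_map mulnDl.
congr (_ + _)%N; case Ax: (A x).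
  by rewrite mul1n; apply: eq_count => y; rewrite /= PE Ax.
by rewrite mul0n (@eq_count _ _ pred0) ?count_pred0 // => y; rewrite /= PE Ax.
Qed.

Lemma has_partitionM A B U V d e : [disjoint A & B]%B ->
  has_partition A U d -> has_partition B V e ->
  has_partition (A :|: B)%SET (U `&` V) (d + e).
Proof.
move=> disAB [D [dD cD]] [E [dE cE]].
have notA i : i \in B -> i \in A = false.
  by move=> iB; apply/negP => iA; have /disjointFr := disAB => /(_ _ iA); rewrite iB.
pose mix (p q : 'X_{1..n} * {set 'I_n}) : 'X_{1..n} * {set 'I_n} :=
  ([multinom if i \in A then p.1 i else q.1 i | i < n],
   ((p.2 :&: A) :|: (q.2 :\: A))%SET).
exists [seq mix p q | p <- D, q <- E]; split=> [_ /allpairsP[[p q] /= [pD qE ->]]|a].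
  apply: leq_trans (leq_add (dD p pD) (dE q qE)) _.
  rewrite -[X in (X <= _)%N]subn0 -[X in (_ - X <= _)%N](cards0 'I_n).
  have <- : ((p.2 :&: A) :&: (q.2 :&: B) = finset.set0)%SET.
    apply/eqP; rewrite -finset.subset0; apply/fintype.subsetP => i; rewrite !inE.
    by case/andP => /andP[_ iA] /andP[_ /notA]; rewrite iA.
  rewrite -cardsU; apply: subset_leq_card; apply/fintype.subsetP => i; rewrite !inE.
  by case/orP => /andP[-> iX]; [rewrite iX|rewrite iX notA //= !orbT].
rewrite (count_allpairs (A := fun p => in_piece A p a) (B := fun q => in_piece B q a)).
  by rewrite cD cE mulnb -asbool_and.
move=> p q; have mix2 i : (i \in (mix p q).2) = if i \in A then i \in p.2 else i \in q.2.
  by rewrite !inE; case: (i \in A); rewrite ?andbT ?andbF ?orbF.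
have mix1 i : (mix p q).1 i = if i \in A then p.1 i else q.1 i by rewrite mnmE.
apply/forall_inP/andP => [h|[/forall_inP hA /forall_inP hB] i].
  split; apply/forall_inP => i iX; have := h i; rewrite finset.in_setU iX ?orbT => /(_ isT).
    by rewrite mix1 mix2 iX.
  by rewrite mix1 mix2 notA.
rewrite finset.in_setU mix1 mix2 => /orP[iA|iB]; first by rewrite iA; exact: hA.
by rewrite (notA i iB); exact: hB.
Qed.

Lemma has_partition_ge W b : has_partition W [set a | forall i, i \in W -> (b i <= a i)%N] #|W|.
Proof.
exists [:: (b, W)]; split=> [p|a /=].
  by rewrite inE => /eqP -> /=; rewrite finset.setIid.
rewrite addn0; congr nat_of_bool; apply/forall_inP/asboolP => h i iW.
  by have := h i iW; rewrite iW.
by rewrite /= iW; exact: h.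
Qed.

Lemma has_partition_full W : has_partition W setT #|W|.
Proof. by apply: has_partition_ext (has_partition_ge W 0%MM) => a; split=> // _ i; rewrite mnm0E. Qed.

Definition zero_on W : set 'X_{1..n} := [set a | forall i, i \in W -> a i = 0%N].

Lemma has_partition_zero W : has_partition W (zero_on W) 0.
Proof.
exists [:: (0%MM, finset.set0)]; split=> // a /=.
rewrite addn0; congr nat_of_bool; apply/forall_inP/asboolP => h i iW.
  by have := h i iW; rewrite inE mnm0E => /eqP.
by rewrite inE mnm0E (h i iW).
Qed.

(** A set decided inside the box [[0, g]^W] is partitioned by the pieces that
    start at its points [b] of the box and are free in the coordinates where
    [b] touches the upper boundary. *)
Lemma has_partition_box W U g : (forall a, U (restrm W (truncm g a)) <-> U a) ->
  has_partition W U 0.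
Proof.
move=> Ug; pose mk (f : {ffun 'I_n -> 'I_g.+1}) : 'X_{1..n} := [multinom (f i : nat) | i < n].
pose ok b := `[< U b >] && (b == restrm W b).
pose codes := [seq b <- [seq mk f | f <- enum {ffun 'I_n -> 'I_g.+1}] | ok b].
pose top b : {set 'I_n} := [set i | b i == g]%SET.
exists [seq (b, top b) | b <- codes]; split=> // a.
pose t := restrm W (truncm g a).
have mk_inj : injective mk.
  move=> f h /mnmP fh; apply/ffunP => i; apply: val_inj.
  by have := fh i; rewrite !mnmE.
rewrite count_map (@eq_in_count _ _ (pred1 t)); last first.
  move=> b; rewrite mem_filter => /andP[/andP[_ /eqP bW] /mapP[f _ bf]] /=.
  have bg i : (b i <= g)%N by rewrite bf mnmE -ltnS.
  have tE i : t i = if i \in W then minn (a i) g else 0%N by rewrite !mnmE.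
  apply/forall_inP/eqP => [h|-> i iW].
    apply/mnmP => i; rewrite tE; case: ifP => iW; last by rewrite bW mnmE iW.
    have := h i iW; rewrite !inE; case: eqP => [-> ga|nbg /eqP ->].
      by apply/esym/minn_idPr.
    by apply/esym/minn_idPl.
  rewrite !inE tE iW; case: (leqP g (a i)) => [ga|ag]; first by rewrite eqxx.
  by rewrite eqxx; case: eqP.
rewrite count_uniq_mem; last by rewrite filter_uniq // map_inj_uniq ?enum_uniq.
congr nat_of_bool; rewrite mem_filter /ok.
have -> : t == restrm W t.
  by apply/eqP/mnmP => i; rewrite !mnmE; case: ifP.
have -> : t \in [seq mk f | f <- enum {ffun 'I_n -> 'I_g.+1}].
  apply/mapP; exists [ffun i => inord (t i)]; first by rewrite mem_enum.
  apply/mnmP => i; rewrite [RHS]mnmE ffunE inordK // !mnmE.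
  by case: ifP => // _; rewrite ltnS geq_minr.
by rewrite !andbT; exact/asbool_equiv_eq/Ug.
Qed.

Lemma exists_subset_card W k : (k <= #|W|)%N -> exists2 A : {set 'I_n}, A \subset W & #|A| = k.
Proof.
move=> kW; exists [set i in take k (enum W)]%SET.
  by apply/fintype.subsetP => i; rewrite inE => /mem_take; rewrite mem_enum.
rewrite cardsE (card_uniqP _) ?take_uniq ?enum_uniq // size_takel //.
by rewrite -cardE.
Qed.

Definition nonzero_on W : set 'X_{1..n} := [set a | exists2 i, i \in W & a i <> 0%N].

Lemma nonzero_onP W a : nonzero_on W a <-> ~ zero_on W a.
Proof.
split=> [[i iW ai] /(_ i iW)//|nz]; apply: contrapT => nn; apply: nz => i iW.
by apply: contrapT => ai; apply: nn; exists i.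
Qed.

Lemma zero_onU A B a : zero_on (A :|: B)%SET a <-> zero_on A a /\ zero_on B a.
Proof.
split=> [h|[hA hB] i]; first by split=> i iX; apply: h; rewrite inE iX ?orbT.
by rewrite inE => /orP[/hA|/hB].
Qed.

(** Cut the variables into three blocks [A], [B], [C]. The exponents that are
    nonzero on all three blocks form a product, of depth at least three times
    that of a block. The others are nonzero on one block, zero on the block
    before it in the cyclic order [A], [B], [C], and arbitrary on the block after
    it; that free block increases the depth. *)
Lemma has_partition_nonzero t W : #|W| = (3 ^ t)%N -> has_partition W (nonzero_on W) t.+1.
Proof.
elim: t W => [|t IHt] W cW.
  have /eqP/cards1P[j ->] := cW.
  exists [:: (U_(j)%MM, [set j]%SET)]; split=> [p|a /=].
    by rewrite inE => /eqP -> /=; rewrite finset.setIid cards1.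
  rewrite addn0; congr nat_of_bool; apply/forall_inP/asboolP => [h|[k /finset.set1P -> aj] i].
    exists j; first exact: set11.
    by have := h j (set11 j); rewrite set11 mnm1E eqxx lt0n => /eqP.
  by move=> /finset.set1P ->; rewrite set11 mnm1E eqxx lt0n; apply/eqP.
have c3 : (#|W| = 3 ^ t + (3 ^ t + 3 ^ t))%N by rewrite cW expnS !mulSn addn0.
have [|A AW cA] := @exists_subset_card W (3 ^ t)%N; first by rewrite c3 leq_addr.
have cWA : #|(W :\: A)%SET| = (3 ^ t + 3 ^ t)%N.
  by rewrite cardsD (finset.setIidPr AW) cA c3 addKn.
have [|B BW cB] := @exists_subset_card (W :\: A)%SET (3 ^ t)%N; first by rewrite cWA leq_addr.
pose C := ((W :\: A) :\: B)%SET.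
have cC : #|C| = (3 ^ t)%N by rewrite cardsD (finset.setIidPr BW) cB cWA addKn.
have memB i : i \in B -> (i \in W) && (i \notin A).
  by move/(fintype.subsetP BW); rewrite inE andbC.
have AB : [disjoint A & B]%B.
  by rewrite disjoint_sym finset.disjoints_subset; apply/fintype.subsetP => i /memB; rewrite inE => /andP[].
have AC : [disjoint A & C]%B.
  by rewrite disjoint_sym finset.disjoints_subset; apply/fintype.subsetP => i; rewrite !inE => /and3P[].
have BC : [disjoint B & C]%B.
  by rewrite disjoint_sym finset.disjoints_subset; apply/fintype.subsetP => i; rewrite !inE => /and3P[].
have WE : W = (A :|: (B :|: C))%SET.
  apply/setP => i; rewrite !inE; case iA: (i \in A); first exact: (fintype.subsetP AW).
  by case iB: (i \in B) => //=; have /andP[-> _] := memB i iB.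
have t3 : (t < 3 ^ t)%N by exact: ltn_expl.
have disU (X Y Z : {set 'I_n}) : [disjoint X & Y]%B -> [disjoint X & Z]%B ->
    [disjoint X & (Y :|: Z)%SET]%B.
  by rewrite !finset.disjoints_subset finset.setCU finset.subsetI => -> ->.
have block (X Y Z : {set 'I_n}) : #|X| = (3 ^ t)%N -> #|Y| = (3 ^ t)%N -> [disjoint X & Y]%B ->
    [disjoint X & Z]%B -> [disjoint Y & Z]%B ->
    has_partition (X :|: (Y :|: Z))%SET (nonzero_on X `&` (setT `&` zero_on Z)) t.+2.
  move=> cX cY XY XZ YZ.
  have h : has_partition (X :|: (Y :|: Z))%SET
      (nonzero_on X `&` (setT `&` zero_on Z)) (t.+1 + (#|Y| + 0)).
    apply: has_partitionM; [|exact: IHt|apply: has_partitionM => //].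
    - exact: disU.
    - exact: has_partition_full.
    - exact: has_partition_zero.
  by apply: has_partition_le h; rewrite addn0 cY -addn1 leq_add // (leq_ltn_trans _ t3).
have hA := block A B C cA cB AB AC BC.
have hB : has_partition W (nonzero_on B `&` (setT `&` zero_on A)) t.+2.
  rewrite WE finset.setUCA (finset.setUC A C); apply: block => //; first by rewrite disjoint_sym.
  by rewrite disjoint_sym.
have hC : has_partition W (nonzero_on C `&` (setT `&` zero_on B)) t.+2.
  rewrite WE (finset.setUA A B C) finset.setUC; apply: block => //; by rewrite disjoint_sym.
have hABC : has_partition W (nonzero_on A `&` (nonzero_on B `&` nonzero_on C)) t.+2.
  have h : has_partition W (nonzero_on A `&` (nonzero_on B `&` nonzero_on C))
      (t.+1 + (t.+1 + t.+1)).
    rewrite WE; apply: has_partitionM; [|exact: IHt|].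
      exact: disU.
    by apply: has_partitionM => //; exact: IHt.
  by apply: has_partition_le h; rewrite -[t.+2]addn1 leq_add.
rewrite -WE in hA.
have hAB := has_partitionU _ hA hB.
have hCABC := has_partitionU _ hC hABC.
apply: (has_partition_ext _ (has_partitionU _ (hAB _) (hCABC _))).
- move=> a; have WE' : zero_on W a <-> zero_on A a /\ zero_on B a /\ zero_on C a.
    by rewrite WE !zero_onU.
  have := nonzero_onP W a; have := nonzero_onP A a; have := nonzero_onP B a.
  have := nonzero_onP C a; rewrite /setU /setI /mkset /=.
  by have [zA|zA] := pselect (zero_on A a); have [zB|zB] := pselect (zero_on B a);
    have [zC|zC] := pselect (zero_on C a); tauto.
- move=> a [[nA [_ zC]]|[nB [_ zA]]] [[/nonzero_onP nC [_ zB]]|[nA' [nB' /nonzero_onP nC']]] //.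
  + by move/nonzero_onP: nB.
  + by move/nonzero_onP: nA'.
- by move=> a [/nonzero_onP nA _] [_ [_ /nA]].
- by move=> a [_ [_ zB]] [_ [/nonzero_onP]].
Qed.

End StanleyPartitions.

(** * Partitions for sums, for ideals containing variables, for a new variable *)

Section PartitionConstructions.
Variable n : nat.
Implicit Types (a b m : 'X_{1..n}) (W A B Y Z : {set 'I_n}) (U V : set 'X_{1..n}).

Lemma in_piece_restrm W p a :
  in_piece [set: _]%SET p (restrm W a)
  = [forall i in ~: W, p.1 i == 0%N] && in_piece W p a.
Proof.
apply/forall_inP/andP => [h|[/forall_inP h0 /forall_inP h] i _].
  split; apply/forall_inP => i iW; have := h i (finset.in_setT i); rewrite mnmE.
    by move: iW; rewrite inE => /negbTE ->; case: ifP => _; rewrite ?leqn0 // eq_sym.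
  by rewrite iW.
rewrite mnmE; have [iW|iW] := boolP (i \in W); first exact: h.
by have /eqP -> : p.1 i == 0%N; [apply: h0; rewrite inE iW|case: ifP].
Qed.

(** A set of exponents which does not constrain the coordinates outside [W]
    is partitioned over [W] by the pieces that start at exponents supported in
    [W]. *)
Lemma has_partition_restr W U d : (forall a, U (restrm W a) <-> U a) ->
  has_partition [set: _]%SET U d -> has_partition W U (d - #|(~: W)%SET|).
Proof.
move=> UW [D [dD cD]].
exists [seq p : 'X_{1..n} * {set 'I_n} <- D | [forall i in ~: W, p.1 i == 0%N]]; split=> [p|a].
  rewrite mem_filter => /andP[_ /dD]; rewrite finset.setIT leq_subLR.
  move/leq_trans; apply; rewrite -(cardsID W p.2) addnC leq_add2r.
  by apply: subset_leq_card; rewrite finset.setDE finset.subsetIr.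
rewrite count_filter -(asbool_equiv_eq (UW a)) -cD.
by apply: eq_count => p; rewrite /= in_piece_restrm andbC.
Qed.

(** Single out one coordinate [j] at a time: either the inequality already fails
    outside [j], and [j] is free, or it fails at [j] only, and all the other
    coordinates are free above [b]. *)
Lemma has_partition_not_ge W b :
  has_partition W [set a | exists2 i, i \in W & (a i < b i)%N] #|W|.-1.
Proof.
elim: {W}#|W| {-2}W (erefl #|W|) => [|k IHk] W cW.
  apply: has_partition_empty => a [i].
  by move/eqP: cW; rewrite cards_eq0 => /eqP ->; rewrite inE.
have [j jW] : exists j, j \in W by apply/card_gt0P; rewrite cW.
have cW' : #|(W :\ j)%SET| = k by move: cW; rewrite (cardsD1 j) jW => -[].
have dis : [disjoint [set j]%SET & (W :\ j)%SET]%B.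
  by rewrite finset.disjoints_subset; apply/fintype.subsetP => i; rewrite !inE => ->.
rewrite cW /= -(finset.setD1K jW).
pose lt_at A : set 'X_{1..n} := [set a | exists2 i, i \in A & (a i < b i)%N].
have h1 : has_partition (j |: (W :\ j))%SET
    (setT `&` lt_at (W :\ j)%SET) (#|[set j]%SET| + k.-1).
  apply: has_partitionM => //; first exact: has_partition_full.
  by rewrite -cW'; apply: IHk.
have h2 : has_partition (j |: (W :\ j))%SET (lt_at [set j]%SET `&`
    [set a | forall i, i \in (W :\ j)%SET -> (b i <= a i)%N]) (0 + k).
  apply: has_partitionM => //; last by rewrite -cW'; exact: has_partition_ge.
  apply: (@has_partition_box _ _ _ (b j)) => a; split=> -[i /finset.set1P -> lt];
    exists j; rewrite ?set11 //; move: lt; rewrite !mnmE set11 gtn_min ltnn orbF //.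
have hU : forall a, (setT `&` lt_at (W :\ j)%SET) a -> (lt_at [set j]%SET `&`
    [set a | forall i, i \in (W :\ j)%SET -> (b i <= a i)%N]) a -> False.
  by move=> a [_ [i iW lt]] [_ /(_ i iW)]; rewrite leqNgt lt.
have := has_partitionU hU (has_partition_le _ h1) (has_partition_le _ h2).
move=> /(_ k) h; apply: (has_partition_ext _ (h _ _)); last by [].
  move=> a; split.
    by move=> [[_ [i iW lt]]|[[i ij lt] _]]; exists i; rewrite // finset.in_setU ?iW ?ij ?orbT.
  move=> [i]; rewrite finset.in_setU => iX lt.
  have [lt'|nlt'] := pselect (lt_at (W :\ j)%SET a); [by left|right].
  split; first by case/orP: iX => iX; [exists i|case: nlt'; exists i].
  by move=> l lW; rewrite leqNgt; apply/negP => ll; apply: nlt'; exists l.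
by rewrite cards1; case: (k).
Qed.

(** If [x^b] is regular modulo the monomial ideal of [U] then [U] does not
    constrain the coordinates in the support of [b], since exponents there can
    be raised and lowered by multiples of [b]. *)
Lemma nzd_restrm U b : upset U -> (forall a, U (b + a)%MM -> U a) ->
  forall a, U (restrm [set i | b i == 0%N]%SET a) <-> U a.
Proof.
move=> upU nzb a; split; first exact/upU/restrm_le.
move=> Ua; set a0 := restrm _ _.
have lower k c : U (b *+ k + c)%MM -> U c.
  elim: k c => [|k IHk] c; first by rewrite mulm0n add0m.
  by rewrite mulmS -addmA => /nzb/IHk.
(* The multiple [mdeg a] of [b] exceeds [a] on the whole support of [b]. *)
apply: (lower (mdeg a)); apply: upU Ua; apply/mnm_lepP => i.
rewrite mnmDE mulmnE mnmE finset.inE; case: eqP => [_|/eqP bi]; first exact: leq_addl.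
rewrite addn0; apply: (@leq_trans (mdeg a)).
  by rewrite mdegE (bigD1 i) //= leq_addr.
by rewrite leq_pmull // lt0n.
Qed.

(** The multiples of [x^b] form one piece of full dimension. The rest of [U] is a
    product: outside the support of [b] restrict a partition of [U], on the
    support take the exponents that are not above [b], at the cost of 1. *)
Lemma has_partition_add_nzd U b d : upset U -> (forall a, U (b + a)%MM -> U a) ->
  (d <= n)%N -> has_partition [set: _]%SET U d ->
  has_partition [set: _]%SET (U `|` [set a | (b <= a)%MM]) d.-1.
Proof.
move=> upU nzb dn hU; set X := [set i | b i == 0%N]%SET.
have UX := nzd_restrm upU nzb.
have hX : has_partition (X :|: ~: X)%SET
    (U `&` [set a | exists2 i, i \in (~: X)%SET & (a i < b i)%N])
    (d - #|(~: X)%SET| + #|(~: X)%SET|.-1).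
  apply: has_partitionM; first by rewrite finset.disjoints_subset finset.setCK.
    exact: has_partition_restr.
  exact: has_partition_not_ge.
rewrite finset.setUCr in hX.
have hb : has_partition [set: _]%SET [set a | forall i, i \in [set: 'I_n]%SET -> (b i <= a i)%N] n.
  by rewrite -[X in has_partition _ _ X]card_ord -cardsT; exact: has_partition_ge.
have disj a : (U `&` [set a | exists2 i, i \in (~: X)%SET & (a i < b i)%N]) a ->
    [set a | forall i, i \in [set: 'I_n]%SET -> (b i <= a i)%N] a -> False.
  by move=> [_ [i _ lt]] /(_ i (finset.in_setT i)); rewrite leqNgt lt.
have := has_partitionU disj (has_partition_le (e := d.-1) _ hX)
  (has_partition_le (e := d.-1) _ hb).
move=> h; apply: (has_partition_ext _ (h _ _)).
- move=> a; split.
    by move=> [[Ua _]|h']; [left|right; apply/mnm_lepP => i; apply: h'; rewrite finset.in_setT].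
  have [ba|nba] := boolP (b <= a)%MM; first by right=> i _; exact/mnm_lepP.
  case=> [Ua|ba]; last by rewrite ba in nba.
  left; split=> //; apply: contrapT => nlt; case/mnm_lepP: nba => i.
  rewrite leqNgt; apply/negP => lt; apply: nlt; exists i => //.
  by rewrite !finset.inE -lt0n (leq_ltn_trans _ lt).
- lia.
- by rewrite (leq_trans (leq_pred d)).
Qed.

(** If [U] contains at least [3 ^ t] variables [Y], the exponents of [U] split
    according to whether their part outside [Y] already lies in [U]: if so the
    part on [Y] is free, otherwise it is any nonzero exponent. *)
Lemma has_partition_variables U Y t : upset U -> (forall j, j \in Y -> U U_(j)%MM) ->
  #|Y| = (3 ^ t)%N -> has_partition [set: _]%SET U t.+1.
Proof.
move=> upU UY cY; have [g gP] := upset_truncm upU.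
pose X := (~: Y)%SET; pose UX : set 'X_{1..n} := [set a | U (restrm X a)].
have boxE a : restrm X (restrm X (truncm g a)) = truncm g (restrm X a).
  by apply/mnmP => i; rewrite !mnmE; case: (i \in X); rewrite ?min0n.
have hUX : has_partition X UX 0.
  by apply: (@has_partition_box _ _ _ g) => a; rewrite /UX /mkset boxE.
have hnUX : has_partition X (~` UX) 0.
  apply: (@has_partition_box _ _ _ g) => a; rewrite /UX /setC /mkset boxE.
  by have := gP (restrm X a); tauto.
have dis : [disjoint X & Y]%B by rewrite finset.disjoints_subset.
have h1 := has_partitionM dis hUX (has_partition_full Y).
have h2 := has_partitionM dis hnUX (has_partition_nonzero cY).
rewrite /X finset.setUC finset.setUCr -/X in h1 h2.
apply: (has_partition_ext _ (has_partitionU _ (has_partition_le _ h1) h2)).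
- move=> a; split.
    move=> [[UXa _]|[_ [i iY ai]]]; first exact: upU (restrm_le _ _) UXa.
    apply: upU (UY i iY); apply/mnm_lepP => k; rewrite mnm1E.
    by case: eqP => // <-; rewrite lt0n; apply/eqP.
  move=> Ua; have [UXa|nUXa] := pselect (UX a); [by left|right].
  split=> //; apply/nonzero_onP => za; apply: nUXa; rewrite /UX /mkset.
  rewrite (_ : restrm X a = a) //; apply/mnmP => i; rewrite mnmE finset.inE.
  by case: (boolP (i \in Y)) => //= /za ->.
- by move=> a [UXa _] [nUXa _].
- by rewrite !add0n cY ltn_expl.
Qed.

(** Some Stanley decomposition exists, so that [sdepth] is a genuine maximum. *)
Lemma has_partition_exists U : upset U -> has_partition [set: _]%SET U 0.
Proof.
move=> /upset_truncm[g gP]; apply: (@has_partition_box _ _ _ g) => a.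
rewrite (_ : restrm _ _ = truncm g a) //.
by apply/mnmP => i; rewrite mnmE finset.in_setT.
Qed.

End PartitionConstructions.

Section PartitionAdjoin.
Variable n : nat.
Implicit Types (U : set 'X_{1..n}) (L : set 'X_{1..n.+1}).
Local Notation widen := (widen_ord (leqnSn n)).

Definition narrowm (a : 'X_{1..n.+1}) : 'X_{1..n} := [multinom a (widen i) | i < n].

Lemma mnmwidenK : cancel (@mnmwiden n) narrowm.
Proof. by move=> a; apply/mnmP => i; rewrite mnmE mnmwiden_widen. Qed.

Lemma narrowm_le a b : (a <= b)%MM -> (narrowm a <= narrowm b)%MM.
Proof. by move=> /mnm_lepP ab; apply/mnm_lepP => i; rewrite !mnmE. Qed.

Lemma ord_max_or_widen (i : 'I_n.+1) : i = ord_max \/ exists j : 'I_n, i = widen j.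
Proof.
case: (unliftP ord_max i) => [j ->|->]; [right; exists j|by left].
by apply: ord_inj; rewrite lift_max.
Qed.

Lemma widen_neq_max (j : 'I_n) : (widen j == ord_max) = false.
Proof. by rewrite -val_eqE /= ltn_eqF. Qed.

(** Restricting a partition to the hyperplane where the last exponent is 0. *)
Lemma has_partition_slice L d : has_partition [set: _]%SET L d ->
  has_partition [set: _]%SET [set a : 'X_{1..n} | L (mnmwiden a)] d.-1.
Proof.
move=> [D [dD cD]].
pose nar (p : 'X_{1..n.+1} * {set 'I_n.+1}) : 'X_{1..n} * {set 'I_n} :=
  (narrowm p.1, [set j | widen j \in p.2]%SET).
pose D0 := [seq p : 'X_{1..n.+1} * {set 'I_n.+1} <- D | p.1 ord_max == 0%N].
exists [seq nar p | p <- D0]; split=> [_ /mapP[p pD ->]|a].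
  move: pD; rewrite mem_filter => /andP[_ /dD]; rewrite !finset.setIT => dp /=.
  rewrite -subn1 leq_subLR; apply: leq_trans dp _.
  have widI : injective widen by move=> i j /(congr1 val) ij; apply: val_inj.
  rewrite -(card_imset _ widI) -(cards1 (ord_max : 'I_n.+1)).
  apply: leq_trans (leq_card_setU _ _); apply: subset_leq_card.
  apply/fintype.subsetP => i ip; rewrite !finset.inE.
  case: (ord_max_or_widen i) => [->|[j ij]]; first by rewrite eqxx.
  by apply/orP; right; rewrite ij; apply: imset_f; rewrite finset.inE -ij.
rewrite count_map count_filter -[RHS]cD; apply: eq_count => p /=.
apply/andP/forall_inP => [[/forall_inP h /eqP p0] i _|h].
  case: (ord_max_or_widen i) => [->|[j ->]].
    by rewrite mnmwiden_ordmax p0; case: ifP.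
  by have := h j (finset.in_setT j); rewrite /= finset.inE mnmE mnmwiden_widen.
split; last first.
  by have := h ord_max (finset.in_setT _); rewrite mnmwiden_ordmax; case: ifP; rewrite ?leqn0 // eq_sym.
apply/forall_inP => j _; have := h (widen j) (finset.in_setT _).
by rewrite /= finset.inE mnmE mnmwiden_widen.
Qed.

(** The multiples of the new variable form one piece, and a partition of [U] can
    be kept on the hyperplane where its exponent is 0. *)
Lemma has_partition_adjoin U d : (d <= n)%N -> has_partition [set: _]%SET U d ->
  has_partition [set: _]%SET [set a : 'X_{1..n.+1} | (0 < a ord_max)%N \/ U (narrowm a)] d.
Proof.
move=> dn [D [dD cD]].
pose wid (p : 'X_{1..n} * {set 'I_n}) : 'X_{1..n.+1} * {set 'I_n.+1} :=
  (mnmwiden p.1, widen @: p.2)%SET.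
have widI : injective widen by move=> i j /(congr1 val) ij; apply: val_inj.
have h1 : has_partition [set: _]%SET [set a : 'X_{1..n.+1} | a ord_max = 0%N /\ U (narrowm a)] d.
  exists [seq wid p | p <- D]; split=> [_ /mapP[p /dD dp ->]|a].
    by move: dp; rewrite !finset.setIT /= card_imset.
  rewrite count_map.
  have inE' p : in_piece [set: _]%SET (wid p) a = (a ord_max == 0%N) && in_piece [set: _]%SET p (narrowm a).
    have wmax : ord_max \in (wid p).2 = false.
      by apply/negP => /imsetP[j _ /eqP]; rewrite eq_sym widen_neq_max.
    have wj j : (widen j \in (wid p).2) = (j \in p.2) by rewrite /= mem_imset.
    apply/forall_inP/andP => [h|[/eqP a0 /forall_inP h] i _].
      split; first by have := h ord_max (finset.in_setT _); rewrite wmax mnmwiden_ordmax.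
      apply/forall_inP => j _; have := h (widen j) (finset.in_setT _).
      by rewrite wj /= mnmwiden_widen mnmE.
    case: (ord_max_or_widen i) => [->|[j ->]]; first by rewrite wmax a0 mnmwiden_ordmax.
    by rewrite wj /= mnmwiden_widen; have := h j (finset.in_setT _); rewrite mnmE.
  rewrite (@eq_count _ _ (fun p => (a ord_max == 0%N) && in_piece [set: _]%SET p (narrowm a))) //.
  have -> : `[< [set a : 'X_{1..n.+1} | a ord_max = 0%N /\ U (narrowm a)] a >]
     = (a ord_max == 0%N) && `[< U (narrowm a) >].
    by rewrite -[_ == _]asboolb -asbool_and; apply: asbool_equiv_eq; split=> -[/eqP].
  by case: eqP => _ /=; [exact: cD|rewrite count_pred0].
have h2 := has_partition_ge [set: 'I_n.+1]%SET U_(ord_max)%MM.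
apply: (has_partition_ext _ (has_partitionU _ h1 (has_partition_le _ h2))).
- move=> a; split.
    move=> [[_ Ua]|/(_ _ (finset.in_setT ord_max))]; first by right.
    by rewrite mnm1E eqxx; left.
  have [a0|a0] := eqVneq (a ord_max) 0%N.
    by move=> [|Ua]; [rewrite a0|left].
  move=> _; right=> i _; rewrite mnm1E; case: eqP => // <-.
  by rewrite lt0n.
- move=> a [a0 _] /(_ _ (finset.in_setT ord_max)).
  by rewrite mnm1E eqxx a0.
- by rewrite cardsT card_ord leqW.
Qed.

End PartitionAdjoin.

(** * Stanley depth of monomial ideals *)

Lemma bigminn_le (I : eqType) (r : seq I) (F : I -> nat) m i :
  i \in r -> (\big[minn/m]_(j <- r) F j <= F i)%N.
Proof.
elim: r => // j r IHr; rewrite inE big_cons geq_min => /predU1P[->|/IHr ->].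
  by rewrite leqnn.
by rewrite orbT.
Qed.

Section StanleyDecompositions.
Variables (K : fieldType) (n : nat).
Local Notation S := {mpoly K[n]}.
Implicit Types (U : set 'X_{1..n}) (Z : {set 'I_n}) (f g : S).

Lemma mcoeff_sum_neq0 (T : Type) (r : seq T) (P : pred T) (F : T -> S) b :
  b \in msupp (\sum_(i <- r | P i) F i) -> exists2 i, P i & b \in msupp (F i).
Proof.
rewrite mcoeff_msupp => sb; apply: contrapT => ni; case/negP: sb.
rewrite raddf_sum big1 // => i Pi; apply/eqP; rewrite -[_ == 0]negbK -mcoeff_msupp.
by apply/negP => ib; apply: ni; exists i.
Qed.

Lemma stanley_spaceP (c : K) a Z g : c != 0 ->
  stanley_space (c *: 'X_[a]) Z g <->
  forall b, b \in msupp g -> in_piece [set: _]%SET (a, Z) b.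
Proof.
move=> c0; split=> [[p pZ <-] b|gZ].
  rewrite -scalerAl => /msuppZ_le/msuppM_le/allpairsP[[a' b'] /= []].
  rewrite msuppX inE => /eqP -> b'p ->; apply/forall_inP => i _ /=.
  rewrite mnmDE; case: ifPn => [_|iZ]; first exact: leq_addr.
  by rewrite (pZ _ b'p) // addn0.
have piece b i : b \in msupp g -> if i \in Z then (a i <= b i)%N else b i == a i.
  by move=> /gZ/forall_inP/(_ i (finset.in_setT i)).
exists (\sum_(b <- msupp g) (g@_b / c) *: 'X_[b - a]).
  move=> e; rewrite big_seq => /mcoeff_sum_neq0[b bg /msuppZ_le].
  rewrite msuppX inE => /eqP -> i iZ; have := piece b i bg.
  by rewrite (negbTE iZ) => /eqP ba; rewrite mnmBE ba subnn.
rewrite mulr_sumr [RHS]mpolyE big_seq [RHS]big_seq; apply: eq_bigr => b bg.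
rewrite -scalerAl -scalerAr scalerA mulrCA divff // mulr1 -mpolyXD addmC submK //.
by apply/mnm_lepP => i; have := piece b i bg; case: ifP => // _ /eqP ->.
Qed.

(** Freeness forces each [m i] to be a nonzero multiple of a monomial, and
    directness of the sum means that no monomial lies in two pieces. *)
Lemma partition_of_decomposition U t (m : 'I_t -> S) (Z : 'I_t -> {set 'I_n}) :
  stanley_decomposition (mono U) m Z ->
  has_partition [set: _]%SET U (sdepth_decomposition Z).
Proof.
move=> [mI mfree IE direct].
have /choice[a aP] i : exists a, exists2 c, c != 0 & m i = c *: 'X_[a].
  have [_ [c [a ma]]] := mI i; exists a; exists c => //.
  apply: contraTneq (oner_neq0 S) => c0; rewrite negbK; apply/eqP.
  apply: (mfree i); last by rewrite ma c0 scale0r mul0r.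
  by move=> b; rewrite msupp1 inE => /eqP -> j _; rewrite mnm0E.
pose P b i := in_piece [set: _]%SET (a i, Z i) b.
have spaceP i g : stanley_space (m i) (Z i) g <-> forall b, b \in msupp g -> P b i.
  by have [c c0 ->] := aP i; exact: stanley_spaceP.
have space0 i : stanley_space (m i) (Z i) 0 by apply/spaceP => b; rewrite msupp0.
have PU b i : P b i -> U b.
  move=> bi; apply/(@mono_X K); rewrite IE.
  exists (fun k => if k == i then 'X_[b] else 0).
    move=> k; case: eqP => [->|_] //; apply/spaceP => b'.
    by rewrite msuppX inE => /eqP ->.
  by rewrite -big_mkcond big_pred1_eq.
have P1 b i j : P b i -> P b j -> j = i.
  move=> bi bj; apply/eqP; apply: contraT => ji.
  have Xb0 : 'X_[b] != 0 :> S by rewrite -msupp_eq0 msuppX.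
  pose g k : S := if k == i then 'X_[b] else if k == j then - 'X_[b] else 0.
  suff : g i = 0 by rewrite /g eqxx => /eqP; rewrite (negbTE Xb0).
  apply: direct => [k|]; rewrite /g.
    case: eqP => [->|_].
      by apply/spaceP => b'; rewrite msuppX inE => /eqP ->.
    case: eqP => [->|_] //.
    by apply/spaceP => b'; rewrite (perm_mem (msuppN _)) msuppX inE => /eqP ->.
  rewrite (bigD1 i) //= eqxx (bigD1 j) //= (negbTE ji) eqxx big1 ?addr0 ?subrr //.
  by move=> k /andP[/negbTE -> /negbTE ->].
have Uex b : U b -> exists i, P b i.
  move=> /(@mono_X K); rewrite IE => -[g gP gE].
  have : b \in msupp (\sum_i g i) by rewrite gE msuppX mem_head.
  by move=> /mcoeff_sum_neq0[i _ bi]; exists i; apply: (spaceP i (g i)).1 bi; exact: gP.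
exists [seq (a i, Z i) | i <- enum 'I_t]; split=> [_ /mapP[i _ ->]|b].
  by rewrite finset.setIT /sdepth_decomposition bigminn_le // mem_index_enum.
rewrite count_map; case: asboolP => [/Uex[i bi]|nU].
  rewrite (@eq_count _ _ (pred1 i)) ?count_uniq_mem ?enum_uniq ?mem_enum // => j /=.
  by apply/idP/eqP => [|->//]; exact: P1.
by rewrite (@eq_count _ _ pred0) ?count_pred0 // => i; apply/negP => /PU.
Qed.

(** Sort the terms of a polynomial according to the piece that contains their
    exponent. *)
Lemma decomposition_of_partition U d : upset U -> (d <= n)%N ->
  has_partition [set: _]%SET U d ->
  exists t (m : 'I_t -> S) (Z : 'I_t -> {set 'I_n}),
    stanley_decomposition (mono U) m Z /\ (d <= sdepth_decomposition Z)%N.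
Proof.
move=> upU dn [D [dD cD]]; pose pc i := tnth (in_tuple D) i.
pose P b i := in_piece [set: _]%SET (pc i) b.
have cP b : #|[pred i | P b i]| = `[< U b >].
  by rewrite -cD -sum1_count big_tnth -sum1_card.
have PU b i : P b i -> U b.
  move=> bi; apply/asboolP; rewrite -[`[< _ >]]lt0b -cP; apply/card_gt0P.
  by exists i.
have P1 b i j : P b i -> P b j -> i = j.
  move=> bi bj; have /card_le1_eqP : (#|[pred i | P b i]| <= 1)%N by rewrite cP leq_b1.
  by apply.
pose m i : S := 'X_[(pc i).1].
have spaceP i g : stanley_space (m i) (pc i).2 g <-> forall b, b \in msupp g -> P b i.
  have -> : m i = 1 *: 'X_[(pc i).1] by rewrite scale1r.
  by rewrite stanley_spaceP ?oner_neq0 // /P; case: (pc i).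
exists (size D), m, (fun i => (pc i).2); split; last first.
  apply: (big_ind (fun k => (d <= k)%N)) => // [k l dk dl|i _].
    by rewrite leq_min dk.
  by have := dD _ (mem_tnth i (in_tuple D)); rewrite finset.setIT.
split.
- move=> i; split; last by exists 1, (pc i).1; rewrite scale1r.
  apply/mono_X/(PU _ i); apply/forall_inP => j _.
  by case: ifP.
- move=> i p _ /eqP; rewrite mulf_eq0 => /orP[|/eqP //].
  by rewrite -msupp_eq0 msuppX.
- apply/seteqP; split=> [f fU|_ [g gP <-]].
    exists (fun i => \sum_(b <- msupp f | P b i) f@_b *: 'X_[b]).
      move=> i; apply/spaceP => e /mcoeff_sum_neq0[b Pb /msuppZ_le].
      by rewrite msuppX inE => /eqP ->.
    rewrite [RHS]mpolyE (exchange_big_dep predT) //= big_seq [RHS]big_seq.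
    apply: eq_bigr => b /fU Ub; rewrite sumr_const cP.
    by case: asboolP => // _; rewrite mulr1n.
  by apply: ideal_sum => [|i _ b]; [exact: mono_ideal|move/((spaceP i _).1 (gP i))/PU].
- move=> g gP g0 i; apply/eqP; apply: contraT => gi0; pose b := mlead (g i).
  have bi : P b i by apply: (spaceP i _).1 (gP i) _ _; exact: mlead_supp.
  have /eqP := congr1 (mcoeff b) g0; rewrite raddf_sum mcoeff0 (bigD1 i) //= big1.
    by rewrite addr0 mleadc_eq0 (negbTE gi0).
  move=> j ji; apply/eqP; rewrite -[_ == 0]negbK -mcoeff_msupp; apply/negP => bj.
  by case/eqP: ji; apply: (P1 b) bi; exact: (spaceP j _).1 (gP j) _ bj.
Qed.

Lemma has_partition_leq_dim U a d : U a -> has_partition [set: _]%SET U d -> (d <= n)%N.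
Proof.
move=> Ua [D [dD cD]]; have : has (fun p => in_piece [set: _]%SET p a) D.
  by rewrite has_count cD; case: asboolP.
case/hasP => p /dD le_d _; apply: leq_trans le_d _.
by rewrite -[X in (_ <= X)%N]card_ord max_card.
Qed.

Lemma leq_sdepthP U a d : upset U -> U a ->
  (d <= sdepth (mono U : set S))%N <-> has_partition [set: _]%SET U d.
Proof.
move=> upU Ua; pose A := [set d | exists (t : nat) (m : 'I_t -> S) (Z : 'I_t -> {set 'I_n}),
    stanley_decomposition (mono U) m Z /\ d = sdepth_decomposition Z].
have Aex e : has_partition [set: _]%SET U e -> exists2 k, A k & (e <= k)%N.
  move=> h; have [t [m [Z [dec le_e]]]] := decomposition_of_partition upU (has_partition_leq_dim Ua h) h.
  by exists (sdepth_decomposition Z) => //; exists t, m, Z.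
have [||Amax Aub] := @nat_maxP A n.
- by have [k Ak _] := Aex 0%N (has_partition_exists upU); exists k.
- by move=> _ [t [m [Z [/partition_of_decomposition/(has_partition_leq_dim Ua) le_n ->]]]].
split=> [led|/Aex[k /Aub Ak dk]]; last exact: leq_trans dk Ak.
have [t [m [Z [/partition_of_decomposition h hE]]]] := Amax.
by apply: has_partition_le h; rewrite -hE.
Qed.

Lemma sdepth_leq_dim U a : upset U -> U a -> (sdepth (mono U : set S) <= n)%N.
Proof.
by move=> upU Ua; have /(leq_sdepthP _ upU Ua)/(has_partition_leq_dim Ua) := leqnn (sdepth (mono U : set S)).
Qed.

End StanleyDecompositions.

(** * Stanley depth under sums and adjunction of a variable *)

Section StanleyDepthComparison.
Variable K : fieldType.

Lemma upsetU n (U V : set 'X_{1..n}) : upset U -> upset V -> upset (U `|` V).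
Proof. by move=> upU upV a b ab [/(upU _ _ ab)|/(upV _ _ ab)]; [left|right]. Qed.

Lemma upset_ge n (b : 'X_{1..n}) : upset [set a | (b <= a)%MM].
Proof. by move=> a c ac /= ba; exact: lepm_trans ba ac. Qed.

Lemma sdepth_add_regular n (U : set 'X_{1..n}) (u : seq 'X_{1..n}) c :
  upset U -> U c -> let us := [seq 'X_[a] | a <- u] : seq {mpoly K[n]} in
  regular_list setT (mono U) us ->
  (sdepth (mono U : set {mpoly K[n]}) <= sdepth (quot_ideal setT (mono U) us) + size u)%N.
Proof.
elim: u U => [|b u IHu] U upU Uc /=; first by rewrite addn0.
rewrite mono_scale mono_add //; last exact: upset_ge.
move=> [nzb rs]; set V := U `|` _ in rs *.
have upV : upset V by apply: upsetU => //; exact: upset_ge.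
have Vc : V c by left.
have nzU a : U (b + a)%MM -> U a.
  move=> /(@mono_X K) Uba; apply/(@mono_X K); apply: nzb => //.
  by rewrite -mpolyXD.
rewrite addnS -addSn; apply: leq_trans (_ : _ <= (sdepth (mono V : set {mpoly K[n]})).+1)%N _.
  rewrite -[X in (_ <= X)%N]add1n -leq_subLR subn1.
  apply/(leq_sdepthP K _ upV Vc); apply: has_partition_add_nzd => //.
    exact: sdepth_leq_dim Uc.
  exact/(leq_sdepthP K _ upU Uc).
by rewrite addSn ltnS; exact: IHu.
Qed.

Lemma extend_ideal_mono n (U : set 'X_{1..n}) : upset U ->
  extend_ideal (mono U) = mono [set a | U (narrowm a)] :> set {mpoly K[n.+1]}.
Proof.
move=> upU; have iE := @extend_ideal_ideal K n (mono U).
have upE : upset [set a | U (narrowm a)] by move=> a b /narrowm_le; exact: upU.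
have iM := mono_ideal K upE.
apply/seteqP; split.
  apply: ideal_gen_sub => // _ [f fU <-]; rewrite [f]mpolyE raddf_sum /= big_seq.
  apply: ideal_sum => // a /fU Ua.
  rewrite mwidenZ mwidenX -mul_mpolyC; apply: (idealMl _ iM).
  by apply/mono_X; rewrite /mkset mnmwidenK.
apply: mono_sub => // a Ua.
have le_a : (mnmwiden (narrowm a) <= a)%MM.
  apply/mnm_lepP => i; case: (ord_max_or_widen i) => [->|[j ->]].
    by rewrite mnmwiden_ordmax.
  by rewrite mnmwiden_widen mnmE.
rewrite -(submK le_a) mpolyXD; apply: (idealMl _ iE).
by rewrite -mwidenX; apply: mwiden_extend; exact/mono_X.
Qed.

Definition adjoin_exp n (U : set 'X_{1..n}) : set 'X_{1..n.+1} :=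
  [set a : 'X_{1..n.+1} | (0 < a ord_max)%N \/ U (narrowm a)].

Lemma adjoin_exp_upset n (U : set 'X_{1..n}) : upset U -> upset (adjoin_exp U).
Proof.
move=> upU a b ab [ay|Ua]; [left|right]; last exact: upU (narrowm_le ab) Ua.
by apply: leq_trans ay _; exact/mnm_lepP.
Qed.

Lemma adjoin_var_mono n (U : set 'X_{1..n}) : upset U ->
  ideal_adjoin_var (mono U) = mono (adjoin_exp U) :> set {mpoly K[n.+1]}.
Proof.
move=> upU; rewrite ideal_adjoin_varE extend_ideal_mono // mono_scale mono_add.
- congr mono; apply/seteqP; split=> a.
    move=> [Ua|/mnm_lepP/(_ ord_max)]; first by right.
    by rewrite mnm1E eqxx; left.
  move=> [ay|Ua]; [right|by left].
  by apply/mnm_lepP => i; rewrite mnm1E; case: eqP => // <-.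
- by move=> a b /narrowm_le; exact: upU.
- exact: upset_ge.
Qed.

(** The partition of [L] is cut by the hyperplane where the exponent of the new
    variable is 0, which loses at most that variable in each piece. *)
Lemma sdepth_slice n (U : set 'X_{1..n}) (L : set 'X_{1..n.+1}) c :
  upset U -> upset L -> U c -> (forall a, L (mnmwiden a) <-> U a) ->
  (sdepth (mono L : set {mpoly K[n.+1]}) <= (sdepth (mono U : set {mpoly K[n]})).+1)%N.
Proof.
move=> upU upL Uc LU; have Lc : L (mnmwiden c) by apply/LU.
rewrite -[X in (_ <= X)%N]add1n -leq_subLR subn1; apply/(leq_sdepthP K _ upU Uc).
by apply: (has_partition_ext LU); apply: has_partition_slice; exact/(leq_sdepthP K _ upL Lc).
Qed.

Lemma sdepth_adjoin_le n (U : set 'X_{1..n}) c : upset U -> U c ->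
  (sdepth (ideal_adjoin_var (mono U : set {mpoly K[n]}))
    <= (sdepth (mono U : set {mpoly K[n]})).+1)%N.
Proof.
move=> upU Uc; rewrite adjoin_var_mono //.
apply: (sdepth_slice upU (adjoin_exp_upset upU) Uc) => a.
rewrite /adjoin_exp /mkset mnmwiden_ordmax mnmwidenK.
by split=> [[]|]; [|by []|right].
Qed.

Lemma sdepth_extend_le n (U : set 'X_{1..n}) c : upset U -> U c ->
  (sdepth (extend_ideal (mono U : set {mpoly K[n]}))
    <= (sdepth (mono U : set {mpoly K[n]})).+1)%N.
Proof.
move=> upU Uc; rewrite extend_ideal_mono //; apply: (sdepth_slice upU _ Uc) => a.
  by move=> b /narrowm_le; exact: upU.
by rewrite /mkset mnmwidenK.
Qed.

Lemma sdepth_adjoin_ge n (U : set 'X_{1..n}) c : upset U -> U c ->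
  (sdepth (mono U : set {mpoly K[n]})
    <= sdepth (ideal_adjoin_var (mono U : set {mpoly K[n]})))%N.
Proof.
move=> upU Uc; rewrite adjoin_var_mono //.
have Lc : adjoin_exp U (mnmwiden c) by right; rewrite mnmwidenK.
apply/(leq_sdepthP K _ (adjoin_exp_upset upU) Lc); apply: has_partition_adjoin.
  exact: sdepth_leq_dim Uc.
exact/(leq_sdepthP K _ upU Uc).
Qed.

Lemma depth_sdepth_variables n (U : set 'X_{1..n}) (Y : {set 'I_n}) t :
  upset U -> ~ U 0%MM -> (forall j, j \in Y -> U U_(j)%MM) -> #|Y| = (3 ^ t)%N ->
  (t < sdepth (mono U : set {mpoly K[n]}))%N /\
  (depth (mono U : set {mpoly K[n]}) + 3 ^ t <= n.+1)%N.
Proof.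
move=> upU U0 UY cY; have Y0 : (0 < #|Y|)%N by rewrite cY expn_gt0.
have /card_gt0P[j jY] := Y0; have Uj := UY j jY; split.
  by apply/(leq_sdepthP K _ upU Uj); exact: has_partition_variables cY.
rewrite -cY; apply: depth_of_variables => //.
- exact: mono_ideal.
- exact: mono_nonzero Uj.
- move=> f fU; apply/eqP; rewrite -[_ == 0]negbK -mcoeff_msupp.
  by apply/negP => /fU.
- by move=> k kY; apply/mono_X; exact: UY.
Qed.

(** The step common to the two nontrivial implications. Starting from a
    monomial ideal with [sdepth < depth], adjoin new variables one by one: the
    depth never decreases and stays below a fixed bound, while the Stanley
    depth grows by at most 1 each time and tends to infinity. Just before it
    catches up with the depth, the three numbers coincide. *)
Lemma exists_critical n (U : set 'X_{1..n}) c :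
  upset U -> U c -> ~ U 0%MM ->
  (sdepth (mono U : set {mpoly K[n]}) < depth (mono U : set {mpoly K[n]}))%N ->
  exists n' (V : set 'X_{1..n'}), [/\ (n <= n')%N, upset V, exists c, V c & ~ V 0%MM] /\
  let I := mono V : set {mpoly K[n']} in
  [/\ (sdepth I < depth I)%N, sdepth (ideal_adjoin_var I) = depth I
    & depth (ideal_adjoin_var I) = depth I].
Proof.
move=> upU Uc U0 bad; apply: contrapT => nocrit.
suff iterate k : exists (V : set 'X_{1..(k + n)}) (Y : {set 'I_(k + n)}),
  [/\ upset V, exists c, V c, ~ V 0%MM, #|Y| = k & forall j, j \in Y -> V U_(j)%MM] /\
  (sdepth (mono V : set {mpoly K[k + n]}) < depth (mono V : set {mpoly K[k + n]}))%N.
  (* With [3 ^ n.+1] new variables the Stanley depth is at least [n + 2], and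
     the depth is at most [n + 1]. *)
  have [V [Y [[upV _ V0 cY VY] badV]]] := iterate (3 ^ n.+1)%N.
  have [lts ltd] := depth_sdepth_variables upV V0 VY cY.
  have := leq_ltn_trans lts badV; rewrite -(leq_add2r (3 ^ n.+1)) => /leq_trans/(_ ltd).
  by rewrite -addnS addnC leq_add2l ltnNge leqnSn.
elim: k => [|k [V [Y [[upV [d Vd] V0 cY VY] badV]]]].
  exists U, finset.set0; split=> //; split=> //; [by exists c|by rewrite cards0|].
  by move=> j; rewrite inE.
pose widen := widen_ord (leqnSn (k + n)).
have widI : injective widen by move=> i j /(congr1 val) ij; apply: val_inj.
exists (adjoin_exp V), (ord_max |: widen @: Y)%SET.
have iV := mono_ideal K upV.
have nzV : ~ ((mono V : set {mpoly K[k + n]}) `<=` [set 0]) by exact: mono_nonzero Vd.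
have led := depth_adjoin_var iV nzV; have les := sdepth_adjoin_le upV Vd.
split; last first.
  rewrite -adjoin_var_mono // ltnNge; apply/negP => le_ds; apply: nocrit.
  exists (k + n)%N, V; split; first by split=> //; [exact: leq_addl|exists d].
  have le_sd := leq_trans les badV; split=> //; apply/eqP; rewrite eqn_leq.
    by rewrite le_sd (leq_trans led le_ds).
  by rewrite led andbT (leq_trans le_ds le_sd).
split.
- exact: adjoin_exp_upset.
- by exists (mnmwiden d); right; rewrite mnmwidenK.
- rewrite /adjoin_exp /mkset mnm0E => -[//|].
  by rewrite -mnmwiden0 mnmwidenK.
- rewrite cardsU1 card_imset // cY; case: imsetP => // -[j _ /eqP].
  by rewrite eq_sym widen_neq_max.
- move=> j; rewrite finset.in_setU1 => /predU1P[->|/imsetP[i iY ->]].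
    by left; rewrite mnm1E eqxx.
  by right; rewrite -mnmwiden1 mnmwidenK; exact: VY.
Qed.

End StanleyDepthComparison.

Lemma quot_ideal_setT (R : comNzRingType) (I : set R) (s : seq R) : is_ideal I ->
  quot_ideal setT I s = ideal_add I (ideal_gen [set` s]).
Proof.
move=> iI; have iJ := ideal_gen_ideal [set` s]; have iT := is_ideal_setT R.
apply/seteqP; split.
  apply: quot_ideal_sub; [exact: ideal_add_ideal|exact: ideal_addl|move=> f a fs _].
  by apply: ideal_addr => //; apply: (idealMr _ iJ); exact: sub_ideal_gen.
apply: ideal_add_sub; [exact: quot_ideal_ideal|exact: quot_ideal_base|].
apply: ideal_gen_sub => [|f fs]; first exact: quot_ideal_ideal.
by rewrite -[f]mulr1; exact: quot_ideal_mem.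
Qed.

Lemma X_irrelevant (K : fieldType) n (a : 'X_{1..n}) :
  a != 0%MM -> irrelevant_ideal ('X_[a] : {mpoly K[n]}).
Proof.
move=> a0; have iM : is_ideal (@irrelevant_ideal K n) by exact: ideal_gen_ideal.
have [i ai] : exists i, a i != 0%N.
  apply: contrapT => na; case/negP: a0; apply/eqP/mnmP => i; rewrite mnm0E.
  by apply/eqP; rewrite -[_ == _]negbK; apply/negP => ai; apply: na; exists i.
have ia : (U_(i) <= a)%MM.
  by apply/mnm_lepP => j; rewrite mnm1E; case: eqP => // <-; rewrite lt0n.
rewrite -(submK ia) mpolyXD; apply: (idealMl _ iM).
exact/irrelevantE/mem_irrelevant_X.
Qed.

Theorem proposition3p1 (K : fieldType) :
  [<-> (forall (n : nat) (I : set {mpoly K[n]}),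
          (1 <= n)%N ->
          proper_nz_monomial_ideal I ->
          (depth I <= sdepth I)%N);
       (forall (n : nat) (I J : set {mpoly K[n]}),
          (1 <= n)%N ->
          proper_nz_monomial_ideal I ->
          proper_nz_monomial_ideal J ->
          (depth (ideal_add I J) <= sdepth (ideal_add I J))%N ->
          (depth I <= sdepth I)%N);
       (forall (n m : nat) (I : set {mpoly K[n]}) (u : m.-tuple 'X_{1..n}),
          (1 <= n)%N -> (1 <= m)%N ->
          proper_nz_monomial_ideal I ->
          let us := [seq 'X_[a] | a <- u] : seq {mpoly K[n]} in
          regular_seq [set: {mpoly K[n]}] I us ->
          let J := ideal_gen [set` us] in
          (depth (ideal_add I J) <= sdepth (ideal_add I J))%N ->
          (depth I <= sdepth I)%N);
       (forall (n m : nat) (I : set {mpoly K[n]}) (u : m.-tuple 'X_{1..n}),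
          (1 <= n)%N -> (1 <= m)%N ->
          proper_nz_monomial_ideal I ->
          let us := [seq 'X_[a] | a <- u] : seq {mpoly K[n]} in
          regular_seq [set: {mpoly K[n]}] I us ->
          let J := ideal_gen [set` us] in
          sdepth (ideal_add I J) = depth (ideal_add I J) ->
          sdepth I = depth I);
       (forall (n : nat) (I : set {mpoly K[n]}),
          (1 <= n)%N ->
          proper_nz_monomial_ideal I ->
          sdepth (ideal_adjoin_var I) = depth I ->
          sdepth I = depth I)].
Proof.
tfae.
- by move=> h1 n I J n1 pI _ _; exact: h1.
- move=> h2 n m I u n1 m1 pI us reg J; apply: h2 => //.
  have [U [upU IU _ _]] := (proper_nz_monomial_idealP I).1 pI.
  have iI : is_ideal I by rewrite IU; exact: mono_ideal.
  have [_ proper] := (regular_seqE us (is_ideal_setT _) iI).1 reg.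
  have JG : J = ideal_gen [set 'X_[a] | a in [set` u]].
    congr ideal_gen; apply/seteqP; split=> [f /mapP[a au ->]|_ [a au <-]].
      by exists a.
    exact: map_f.
  have [a au] : exists a, a \in u.
    by case: {+}m u m1 {us reg J proper JG} => // k u _; exists (thead u); exact: mem_tnth.
  split; first by exists [set` u].
    move=> J0; have : J 'X_[a] by apply: sub_ideal_gen; exact: map_f.
    by rewrite J0 => /eqP; rewrite -msupp_eq0 msuppX.
  move=> JT; apply: proper; rewrite quot_ideal_setT //.
  by rewrite -[X in X `<=` _]JT; exact: ideal_addr.
- move=> h3 n m I u n1 m1 pI us reg J sd.
  have le_ds : (depth I <= sdepth I)%N by apply: (h3 n m I u) => //; rewrite -/us -/J sd.
  apply/eqP; rewrite eqn_leq le_ds andbT.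
  have [U [upU IU [c Uc] _]] := (proper_nz_monomial_idealP I).1 pI.
  have iI : is_ideal I by rewrite IU; exact: mono_ideal.
  have I0 : ~ (I `<=` [set 0]) by rewrite IU; exact: mono_nonzero Uc.
  have [rs proper] := (regular_seqE us (is_ideal_setT _) iI).1 reg.
  (* If some entry were 1 the quotient by the sequence would vanish. *)
  have mus f : f \in us -> irrelevant_ideal f.
    move=> fus; have /mapP[a _ fa] := fus; rewrite fa; apply: X_irrelevant.
    apply: contra_notN proper => /eqP a0 g _; rewrite quot_ideal_setT //.
    have iJ := ideal_gen_ideal [set` us].
    apply: ideal_addr => //; rewrite -[g]mulr1; apply: (idealMl _ iJ).
    by apply: sub_ideal_gen; move: fus; rewrite fa a0 mpolyX0.
  have := depth_add_regular iI I0 mus rs.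
  have := @sdepth_add_regular K n U u c upU Uc; rewrite -/us -IU => /(_ rs).
  rewrite quot_ideal_setT // -/J sd size_map size_tuple => le_s; apply: leq_trans.
  by rewrite leq_min le_s IU (sdepth_leq_dim K upU Uc).
- move=> h4.
  (* Assertion (1) suffices, because [sdepth I <= sdepth (I, y)]. *)
  suff h1 n (I : set {mpoly K[n]}) : (1 <= n)%N -> proper_nz_monomial_ideal I ->
      (depth I <= sdepth I)%N.
    move=> n I n1 pI sd; apply/eqP; rewrite eqn_leq h1 // andbT -sd.
    have [U [upU -> [c Uc] _]] := (proper_nz_monomial_idealP I).1 pI.
    exact: sdepth_adjoin_ge Uc.
  move=> n1 /proper_nz_monomial_idealP[U [upU -> [c Uc] U0]].
  rewrite leqNgt; apply/negP => /(exists_critical upU Uc U0).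
  case=> n' [V [[nn' upV [d Vd] V0] [bad sd dd]]].
  set I' := mono V in bad sd dd.
  have iI' : is_ideal I' by exact: mono_ideal.
  have nzI' : ~ (I' `<=` [set 0]) by exact: mono_nonzero Vd.
  have upE : upset [set a | V (narrowm a)] by move=> a b /narrowm_le; exact: upV.
  have iE := @extend_ideal_ideal K n' I'.
  have JE : ideal_add (extend_ideal I')
      (ideal_gen [set` [seq 'X_[a] | a <- [tuple U_(ord_max)%MM : 'X_{1..n'.+1}]]])
      = ideal_adjoin_var I'.
    rewrite ideal_adjoin_varE scale_setT_X; congr (ideal_add _ (ideal_gen _)).
    by apply/seteqP; split=> f /=; rewrite inE => /eqP.
  have ext : sdepth (extend_ideal I') = depth (extend_ideal I').
    apply: (h4 n'.+1 1%N _ [tuple U_(ord_max)%MM]) => //.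
    - apply/proper_nz_monomial_idealP; exists [set a | V (narrowm a)].
      split=> //; first exact: extend_ideal_mono.
        by exists (mnmwiden d); rewrite /mkset mnmwidenK.
      by rewrite /mkset -mnmwiden0 mnmwidenK.
    - apply/regular_seqE => //; split.
        by split=> // a _; exact: extend_ideal_nzd_y.
      rewrite quot_ideal_setT // JE adjoin_var_mono // => /(_ 1 Logic.I)/(_ 0%MM).
      rewrite msupp1 mem_head => /(_ isT)[|]; first by rewrite mnm0E.
      by rewrite -mnmwiden0 mnmwidenK.
    - by rewrite JE sd dd.
  have := depth_extend_ideal iI' nzI'; rewrite -ext.
  move=> /leq_trans/(_ (sdepth_extend_le K upV Vd)).
  by rewrite ltnS leqNgt bad.
- move=> h5 n I n1 /proper_nz_monomial_idealP[U [upU -> [c Uc] U0]].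
  rewrite leqNgt; apply/negP => /(exists_critical upU Uc U0).
  case=> n' [V [[nn' upV exV V0] [bad sd _]]].
  move: bad; rewrite (h5 n' (mono V)) ?ltnn //; first exact: leq_trans nn'.
  by apply/proper_nz_monomial_idealP; exists V.
Qed.
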